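(* Let $\bar{\mathcal{H}}(t):=\int_0^1\mathcal{H}(t,s)\,ds$, let $K\in\mathbb{K}^{p,q}$, and suppose that $\mathcal{H}$ satisfies the assumptions listed in the context. Then there is a constant $C_1$, independent of $\varepsilon$ and $\tau$ (but possibly depending on $p,q,K$ and on the fixed field $\mathcal{H}$), such that for every small parameter $0<\varepsilon<1$, every $\tau>\varepsilon$, every $t_a$ with $[t_a-\tau/2,t_a+\tau/2]\subset[0,T]$, and every $\mathbf{M}\in\mathbb{R}^3$ the following holds. If $\mathbf{m}^{\varepsilon}:[-\tau/2,\tau/2]\to\mathbb{R}^3$ solves the micro problem $$\frac{d}{dt}\mathbf{m}^{\varepsilon}(t)=-\mathcal{H}\Big(t+t_a,\frac{t+t_a}{\varepsilon}\Big)\mathbf{m}^{\varepsilon}(t),\quad t\in[-\tau/2,\tau/2],\qquad \mathbf{m}^{\varepsilon}(0)=\mathbf{M},$$ and $$\mathbf{F}(t_a,\mathbf{M}):=\int_{-\tau/2}^{\tau/2}K_{\tau}(s)\,\frac{d}{ds}\mathbf{m}^{\varepsilon}(s)\,ds ,$$ then $$\left|\mathbf{F}(t_a,\mathbf{M})+\bar{\mathcal{H}}(t_a)\mathbf{M}\right|\le C_1\left(\tau+\left(\frac{\varepsilon}{\tau}\right)^{q+2}\right)|\mathbf{M}|.$$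
   Context: $|\cdot|$ is the Euclidean norm on $\mathbb{R}^3$. Field: $T>0$ and $\mathcal{H}:[0,T]\times\mathbb{R}\to\mathbb{R}^{3\times3}$ is a skew-symmetric matrix function of the form $$\mathcal{H}=\begin{pmatrix}0&H_3&-H_2\\-H_3&0&H_1\\H_2&-H_1&0\end{pmatrix}$$ (so $\mathcal{H}\mathbf{v}=\mathbf{v}\times\mathbf{H}$ with $\mathbf{H}=(H_1,H_2,H_3)$), such that $\mathcal{H}(t,\cdot)$ is $1$-periodic, its entries belong to $C^\infty([0,T]\times[0,1])$, and there is a constant $c_1$ with $|\partial_t^k\mathcal{H}(t,s)\mathbf{v}|\le c_1|\mathbf{v}|$ for $k=0,1$, all $\mathbf{v}\in\mathbb{R}^3$, $t\in[0,T]$, $s\in\mathbb{R}$ (here $\partial_t$ is the derivative in the first argument). Kernels: for integers $p\ge 0$, $q\ge-1$, $K\in\mathbb{K}^{p,q}$ means that $K:\mathbb{R}\to\mathbb{R}$ has compact support in $[-1/2,1/2]$, $K(t)=K(-t)$, the weak derivative $K^{(q+1)}$ belongs to $BV(\mathbb{R})$ (bounded total variation), and $\int_{\mathbb{R}}K(t)\,dt=1$, $\int_{\mathbb{R}}K(t)t^r\,dt=0$ for integers $0<r\le p$. The scaled kernel is $K_\tau(t):=\frac1\tau K(t/\tau)$. *)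

(* Defs.v *)
From HB Require Import structures.
From mathcomp Require Import all_boot all_order all_algebra.
From mathcomp Require Import all_classical all_reals all_analysis.

Set Implicit Arguments.
Unset Strict Implicit.
Unset Printing Implicit Defensive.

Import Order.TTheory GRing.Theory Num.Theory.
Import numFieldNormedType.Exports.

Local Open Scope classical_set_scope.
Local Open Scope ring_scope.

(* The library's norm on matrices is the sup norm. *)
Definition enorm (R : realType) (n : nat) (v : 'cV[R]_n) : R :=
  Num.sqrt (\sum_(i < n) v i 0 ^+ 2).

(* Derivatives relative to a set: the limit of the difference quotient is taken
   along the points of A only, hence is one-sided at an endpoint when A is an
   interval, and the values of f outside A are irrelevant. *)
Definition diffquot_within (R : realType) (V : normedModType R) (A : set R)
    (f : R -> V) (x : R) : set_system V :=
  (fun u => (u - x)^-1 *: (f u - f x)) @ within A x^'.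

Definition derivable_within (R : realType) (V : normedModType R) (A : set R)
    (f : R -> V) (x : R) : Prop :=
  cvg (diffquot_within A f x).

Definition derive_within (R : realType) (V : normedModType R) (A : set R)
    (f : R -> V) (x : R) : V :=
  lim (diffquot_within A f x).

Definition partial1 (R : realType) (V : normedModType R) (A : set R)
    (f : R -> R -> V) : R -> R -> V :=
  fun t s => derive_within A (fun u => f u s) t.

Definition partial2 (R : realType) (V : normedModType R) (B : set R)
    (f : R -> R -> V) : R -> R -> V :=
  fun t s => derive_within B (f t) s.

Fixpoint Cn_on (R : realType) (A B : set R) (n : nat) (f : R -> R -> R) : Prop :=
  {within A `*` B, continuous (fun z : R * R => f z.1 z.2)} /\
  match n with
  | 0 => True
  | n'.+1 =>
    [/\ forall t s, A t -> B s ->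
          derivable_within A (fun u => f u s) t /\ derivable_within B (f t) s,
        Cn_on A B n' (partial1 A f) &
        Cn_on A B n' (partial2 B f)]
  end.

Definition smooth_on (R : realType) (A B : set R) (f : R -> R -> R) : Prop :=
  forall n, Cn_on A B n f.

Definition skew_mx (R : realType) (h1 h2 h3 : R) : 'M[R]_3 :=
  \matrix_(i < 3, j < 3)
    nth 0 (nth [::] [:: [::    0;   h3; - h2];
                        [:: - h3;    0;   h1];
                        [::   h2; - h1;    0]] i) j.

(* Smoothness is required on the closed cell [0, T] x [0, 1] only, so the
   s-derivatives of the periodic function H t need not match across integers. *)
Record field_assumptions (R : realType) (T : R) (H : R -> R -> 'M[R]_3) : Prop := {
  field_skew : exists H1 H2 H3 : R -> R -> R, forall t s : R, 0 <= t <= T ->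
    H t s = skew_mx (H1 t s) (H2 t s) (H3 t s);
  field_periodic : forall t s : R, 0 <= t <= T -> H t (s + 1) = H t s;
  field_smooth : forall i j : 'I_3, smooth_on `[0, T]%classic `[0, 1]%classic (fun t s => H t s i j);
  field_bound : exists c1 : R, forall (k : nat) (v : 'cV[R]_3) (t s : R),
    (k <= 1)%N -> 0 <= t <= T ->
    enorm (iter k (partial1 `[0, T]%classic) H t s *m v) <= c1 * enorm v
}.

Definition average (R : realType) (H : R -> R -> 'M[R]_3) (t : R) : 'M[R]_3 :=
  \matrix_(i < 3, j < 3) \int[@lebesgue_measure R]_(s in `[0, 1]%classic) H t s i j.

Definition supp (R : realType) (f : R -> R) : set R := closure [set x | f x != 0].

Definition test_function (R : realType) (phi : R -> R) : Prop :=
  (forall (n : nat) (x : R), derivable (derive1n n phi) x 1) /\ compact (supp phi).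

(* For n = 0 this says that f = g almost everywhere. *)
Definition weak_derivative (R : realType) (n : nat) (f g : R -> R) : Prop :=
  [/\ locally_integrable setT f, locally_integrable setT g &
    forall phi : R -> R, test_function phi ->
      \int[@lebesgue_measure R]_x (f x * derive1n n phi x) =
      (-1) ^+ n * \int[@lebesgue_measure R]_x (g x * phi x)].

Definition BV (R : realType) (g : R -> R) : Prop :=
  exists C : R, forall a b : R, a <= b -> (total_variation a b g <= C%:E)%E.

(* Weak derivatives are defined up to null sets: membership in BV is asked of
   one representative. *)
Record kernel_class (R : realType) (p : nat) (q : int) (K : R -> R) : Prop := {
  kernel_supp : supp K `<=` `[- 2^-1, 2^-1]%classic;
  kernel_even : forall t : R, K t = K (- t);
  kernel_BV : exists g : R -> R, weak_derivative (absz (q + 1)) K g /\ BV g;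
  kernel_mass : \int[@lebesgue_measure R]_t K t = 1;
  kernel_moments : forall r : nat, (0 < r <= p)%N ->
    \int[@lebesgue_measure R]_t (K t * t ^+ r) = 0
}.

Definition scaled_kernel (R : realType) (K : R -> R) (tau : R) : R -> R :=
  fun t => tau^-1 * K (t / tau).

Definition micro_window (R : realType) (tau : R) : set R :=
  `[- (tau / 2), tau / 2]%classic.

Definition micro_solution (R : realType) (H : R -> R -> 'M[R]_3)
    (eps tau ta : R) (M : 'cV[R]_3) (m : R -> 'cV[R]_3) : Prop :=
  (forall t : R, micro_window tau t ->
     derivable_within (micro_window tau) m t /\
     derive_within (micro_window tau) m t =
       - (H (t + ta) ((t + ta) / eps) *m m t)) /\
  m 0 = M.

Definition flux (R : realType) (K : R -> R) (tau : R) (m : R -> 'cV[R]_3) :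
    'cV[R]_3 :=
  \col_(i < 3) \int[@lebesgue_measure R]_(s in micro_window tau)
    (scaled_kernel K tau s * derive_within (micro_window tau) m s i 0).

(* Main.v *)
Require Import Defs.
From HB Require Import structures.
From mathcomp Require Import all_boot all_order all_algebra.
From mathcomp Require Import all_classical all_reals all_analysis.
From mathcomp Require Import measurable_realfun ring lra.

(* Since |m| is conserved (the matrix is skew-symmetric) and the field is Lipschitz,
   the velocity dm/ds differs by O(tau |M|) from -H(t_a, (s + t_a) / eps) M on the
   window, so the flux is, up to this error, the integral against K of a 1-periodic
   function of rapid argument l u + b with l = tau / eps, whose mean is removed by
   the averaged field.  There remains to bound the integral of K(u) f(l u + b) for f
   periodic of mean zero: approximate f by a smooth g, take as test function the
   (q+1)-fold mean-zero primitive of g(l u + b) times a cutoff, which trades K for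
   its weak derivative at the price l^-(q+1), and gain the last factor 1/l by
   summing the oscillation of that BV function over the cells of length 1/l. *)

Set Implicit Arguments.
Unset Strict Implicit.
Unset Printing Implicit Defensive.

Import Order.TTheory GRing.Theory Num.Theory.
Import numFieldNormedType.Exports.

Local Open Scope classical_set_scope.
Local Open Scope ring_scope.

(** * Smooth functions *)

(** The field is smooth only up to the boundary of the unit cell, so in the fast variable its
    periodic extension may have corners at the integers and is in general no better than Lipschitz.
    Its primitives are then not infinitely differentiable, hence not legitimate factors of a test
    function: this forces the smooth approximation. Letting the accuracy tend to zero is harmless
    only if the oscillation estimate sees the approximant through its sup norm alone, since its
    Lipschitz constant is not controlled. This is why primitives are normalised to mean zero: each
    one stays periodic and obeys the same sup bound as the function it integrates. The
    representative [g] of the weak derivative is not known to vanish pointwise outside the support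
    of [K], so the cutoff stays in the estimate and the increments of the product of [g] and the
    cutoff are controlled. All constants are fixed by [K] and by sup and Lipschitz bounds of the
    field before the small parameters appear; conservation of the norm avoids any exponential growth
    factor. *)

Lemma is_derive1D (R : realType) (f g : R -> R) (x a b : R) :
  is_derive x 1 f a -> is_derive x 1 g b ->
  is_derive x 1 (fun y => f y + g y) (a + b).
Proof. exact: is_deriveD. Qed.

Lemma is_derive1M (R : realType) (f g : R -> R) (x a b : R) :
  is_derive x 1 f a -> is_derive x 1 g b ->
  is_derive x 1 (fun y => f y * g y) (a * g x + f x * b).
Proof.
move=> fa gb; rewrite addrC [a * _]mulrC; exact: is_deriveM.
Qed.

(** Settles differentiability of the flat functions at the origin, where their two defining formulas
    meet. *)
Lemma is_derive0_le_sqr (R : realType) (f : R -> R) (C : R) :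
  (forall y, `|f y| <= C * y ^+ 2) -> is_derive (0 : R) 1 f 0.
Proof.
move=> fC; have f0 : f 0 = 0.
  by apply/eqP; rewrite -normr_le0 (le_trans (fC 0))// expr0n mulr0.
have Cge0 : 0 <= C by have := fC 1; rewrite expr1n mulr1; exact: le_trans.
have H : h^-1 *: (f (h *: 1 + 0) - f 0) @[h --> 0^'] --> (0 : R).
  apply/cvgrPdist_le => e e0; near=> h.
  have h0 : h != 0 by near: h; exact: nbhs_dnbhs_neq.
  rewrite addr0 f0 subr0 sub0r normrN [h *: 1]mulr1 normrZ normfV.
  rewrite ler_pdivrMl ?normr_gt0//; apply: (le_trans (fC h)).
  rewrite -real_normK ?num_real// expr2 mulrCA ler_wpM2l//.
  have : `|h| <= e / (C + 1).
    near: h; apply: dnbhs0_le; rewrite divr_gt0// ltr_wpDl//.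
  rewrite ler_pdivlMr ?ltr_wpDl// => /(le_trans _); apply.
  by rewrite mulrDr mulr1 [C * _]mulrC lerDl.
split; first by apply/cvg_ex; exists 0; exact: H.
exact: (@cvg_lim R^o).
Unshelve. all: by end_near. Qed.

(** The classical flat function exp(-1/x), multiplied by x^-k on the positive side. The index k
    makes the span of the family stable under differentiation. *)
Definition flat_exp (R : realType) (k : nat) (x : R) : R :=
  if 0 < x then expR (- x^-1) * x^-1 ^+ k else 0.

Lemma flat_exp_ge0 (R : realType) k (x : R) : 0 <= flat_exp k x.
Proof.
by rewrite /flat_exp; case: ifP => // x0; rewrite mulr_ge0 ?expR_ge0 ?exprn_ge0 ?invr_ge0 ?ltW.
Qed.

Lemma flat_exp_gt0 (R : realType) (x : R) : 0 < x -> 0 < flat_exp 0 x.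
Proof. by move=> x0; rewrite /flat_exp x0 expr0 mulr1 expR_gt0. Qed.

Lemma flat_exp_le0 (R : realType) k (x : R) : x <= 0 -> flat_exp k x = 0.
Proof. by move=> x0; rewrite /flat_exp ltNge x0. Qed.

(** With y = 1/x, the exponential series gives exp y >= y^(k+2) / (k+2)!, which leaves a factor x^2
    after division by x^k. *)
Lemma flat_exp_le_sqr (R : realType) k (x : R) :
  `|flat_exp k x| <= k.+2`!%:R * x ^+ 2.
Proof.
rewrite ger0_norm ?flat_exp_ge0// /flat_exp; case: ifPn => x0; last first.
  by rewrite mulr_ge0 ?ler0n ?sqr_ge0.
rewrite expRN exprVn -invfM -[leRHS]invrK lef_pV2 ?posrE; last 2 first.
- by rewrite mulr_gt0 ?expR_gt0 ?exprn_gt0.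
- by rewrite invr_gt0 mulr_gt0 ?ltr0n ?fact_gt0 ?exprn_gt0.
have := expR_ge1Dxn k.+1 (ltW (_ : 0 < x^-1)); rewrite invr_gt0 => /(_ x0) H.
have {}H : x^-1 ^+ k.+2 / k.+2`!%:R <= expR x^-1.
  by apply: le_trans H; rewrite lerDr.
apply: le_trans (ler_wpM2r (ltW (exprn_gt0 k x0)) H).
rewrite le_eqVlt; apply/orP; left; apply/eqP.
rewrite -addn2 exprD exprVn; field.
by rewrite !gt_eqF ?exprn_gt0// ltr0n fact_gt0.
Qed.

Lemma is_derive_flat_exp (R : realType) k (x : R) :
  is_derive x 1 (@flat_exp R k) (flat_exp k.+2 x - k%:R * flat_exp k.+1 x).
Proof.
case: (ltgtP x 0) => [x0|x0|->]; last 1 first.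
- rewrite !flat_exp_le0// mulr0 subrr.
  exact: is_derive0_le_sqr (@flat_exp_le_sqr R k).
- rewrite !flat_exp_le0 ?ltW// mulr0 subrr.
  apply: (near_eq_is_derive (f := cst 0)).
  near=> y; rewrite flat_exp_le0//; apply/ltW; near: y.
  exact: lt_nbhsl.
- rewrite /flat_exp x0.
  apply: (near_eq_is_derive (f := fun y : R => expR (- y^-1) * y^-1 ^+ k)).
    near=> y; suff -> : 0 < y by [].
    by near: y; exact: lt_nbhsr.
  have dV : is_derive x 1 (fun y : R => y^-1) (- x ^- 2).
    have := @is_deriveV R id x 1 1 (lt0r_neq0 x0) _.
    by move=> H; apply: is_derive_eq; rewrite [LHS]mulr1.
  have dE : is_derive x 1 (fun y : R => expR (- y^-1)) (expR (- x^-1) * x^-1 ^+ 2).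
    have := @is_derive1_comp R expR (fun y : R => - y^-1) x _ _ (is_derive_expR _) (is_deriveN dV).
    by rewrite opprK exprVn.
  have dX : is_derive x 1 (fun y : R => y^-1 ^+ k) ((k%:R * x^-1 ^+ k.-1) * (- x ^- 2)).
    have dP : is_derive (x^-1) 1 (fun y : R => y ^+ k) (k%:R * x^-1 ^+ k.-1).
      apply: DeriveDef; first exact: exprn_derivable.
      by rewrite exp_derive /GRing.scale /= mulr1.
    exact: (is_derive1_comp dP dV).
  apply: is_derive_eq (is_derive1M dE dX) _.
  case: k {dX} => [|k] /=; first by rewrite !mul0r mulr0 subr0 expr0 mulr1 addr0.
  rewrite -exprVn !exprS expr0; set e := expR _; set y := x^-1; set c := _%:R; ring.
Unshelve. all: by end_near. Qed.

(* An inductive stock of smooth functions, closed under primitives: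
   [smooth_derive] makes the class stable under differentiation, hence all its
   members are infinitely differentiable. *)
Inductive smooth (R : realType) : (R -> R) -> Prop :=
| smooth_cst c : smooth (fun=> c)
| smooth_id : smooth id
| smooth_add f g : smooth f -> smooth g -> smooth (fun x => f x + g x)
| smooth_mul f g : smooth f -> smooth g -> smooth (fun x => f x * g x)
| smooth_comp f g : smooth f -> smooth g -> smooth (fun x => f (g x))
| smooth_inv f : smooth f -> (forall x, f x != 0) -> smooth (fun x => (f x)^-1)
| smooth_expR : smooth expR
| smooth_cos : smooth cos
| smooth_sin : smooth sin
| smooth_flat_exp k : smooth (@flat_exp R k)
| smooth_primitive (F f : R -> R) :
    smooth f -> (forall x : R, is_derive x 1 F (f x)) -> smooth F.

Lemma smooth_scale (R : realType) (c : R) f : smooth f -> smooth (fun x => c * f x).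
Proof. by move=> sf; apply: smooth_mul => //; exact: smooth_cst. Qed.

Lemma smooth_sum (R : realType) (I : Type) (r : seq I) (f : I -> R -> R) :
  (forall i, smooth (f i)) -> smooth (fun x => \sum_(i <- r) f i x).
Proof.
move=> sf; elim: r => [|i r ih].
  by under eq_fun do rewrite big_nil; exact: smooth_cst.
by under eq_fun do rewrite big_cons; exact: smooth_add.
Qed.

Lemma smooth_derive (R : realType) (f : R -> R) : smooth f ->
  exists2 g, smooth g & forall x : R, is_derive x 1 f (g x).
Proof.
elim=> {f}.
- by move=> c; exists (fun=> 0) => [|x]; [exact: smooth_cst|exact: is_derive_cst].
- by exists (fun=> 1) => [|x]; [exact: smooth_cst|exact: is_derive_id].
- move=> f g _ [f' sf' df] _ [g' sg' dg]; exists (fun x => f' x + g' x).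
    exact: smooth_add.
  by move=> x; exact: is_derive1D.
- move=> f g sf [f' sf' df] sg [g' sg' dg].
  exists (fun x => f' x * g x + f x * g' x).
    by apply: smooth_add; exact: smooth_mul.
  by move=> x; exact: is_derive1M.
- move=> f g sf [f' sf' df] sg [g' sg' dg].
  exists (fun x => f' (g x) * g' x).
    by apply: smooth_mul => //; exact: smooth_comp.
  by move=> x; exact: is_derive1_comp.
- move=> f sf [f' sf' df] f0.
  exists (fun x => -1 * ((f x)^-1 * (f x)^-1) * f' x).
    have sV := smooth_inv sf f0.
    by apply: smooth_mul => //; apply: smooth_scale; exact: smooth_mul.
  move=> x; apply: is_derive_eq (is_deriveV (f0 x) (df x)) _.
  by rewrite mulN1r -invfM -expr2.
- by exists expR => [|x]; [exact: smooth_expR|exact: is_derive_expR].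
- exists (fun x => -1 * sin x); first by apply: smooth_scale; exact: smooth_sin.
  by move=> x; rewrite mulN1r; exact: is_derive_cos.
- by exists cos => [|x]; [exact: smooth_cos|exact: is_derive_sin].
- move=> k; exists (fun x => flat_exp k.+2 x + (- k%:R) * flat_exp k.+1 x).
    by apply: smooth_add; last apply: smooth_scale; exact: smooth_flat_exp.
  by move=> x; rewrite mulNr; exact: is_derive_flat_exp.
- by move=> F f sf _ dF; exists f.
Qed.

Lemma smooth_derivable (R : realType) (f : R -> R) n x :
  smooth f -> derivable (derive1n n f) x 1.
Proof.
move=> sf; suff {x} : smooth (derive1n n f).
  by move=> /smooth_derive[g _ /(_ x)[]].
elim: n f sf => [//|n ih] f /smooth_derive[g sg dg].
rewrite derive1Sn (_ : derive1 f = g); first exact: ih.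
by apply/funext => x; rewrite derive1E; exact: derive_val.
Qed.

Lemma smooth_continuous (R : realType) (f : R -> R) : smooth f -> continuous f.
Proof.
move=> /smooth_derive[g _ dg] x.
exact/differentiable_continuous/derivable1_diffP/ex_derive.
Qed.

(** Allows a cutoff to be dropped under iterated derivatives on the open set where it equals 1. *)
Lemma derive1n_near (R : realType) (f g : R -> R) (U : set R) n : open U ->
  {in U, f =1 g} -> {in U, derive1n n f =1 derive1n n g}.
Proof.
move=> oU; elim: n f g => [//|n ih] f g fg; rewrite !derive1Sn; apply: ih.
move=> x xU; rewrite !derive1E; apply: near_eq_derive.
have : \near x, U x by apply: open_nbhs_nbhs; split=> //; exact: set_mem.
by apply: filterS => y yU; apply: fg; exact: mem_set.
Qed.

(** * Primitives of periodic functions *)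

Lemma continuous_integrable_itv (R : realType) (f : R -> R) (a b : R) :
  continuous f -> lebesgue_measure.-integrable `[a, b] (EFin \o f).
Proof.
move=> cf; apply: continuous_compact_integrable; first exact: segment_compact.
exact: continuous_subspaceT.
Qed.

Lemma Rintegral_itv_split (R : realType) (f : R -> R) (a b c : R) :
  a <= b -> b <= c -> (@lebesgue_measure R).-integrable `[a, c] (EFin \o f) ->
  \int[@lebesgue_measure R]_(x in `[a, c]) f x =
  \int[@lebesgue_measure R]_(x in `[a, b]) f x +
  \int[@lebesgue_measure R]_(x in `[b, c]) f x.
Proof.
move=> ab bc fi.
have := @Rintegral_itvB R f (BLeft a) (BRight c) b fi.
rewrite !bnd_simp => /(_ ab bc) /eqP; rewrite subr_eq => /eqP ->.
rewrite Rintegral_itv_obnd_cbnd; first by rewrite addrC.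
by apply: integrableS fi => //; apply: subset_itvr; rewrite bnd_simp.
Qed.

Lemma ler_norm_Rintegral_itv (R : realType) (f : R -> R) (a b B : R) : a <= b ->
  (@lebesgue_measure R).-integrable `[a, b] (EFin \o f) ->
  (forall x, a <= x <= b -> `|f x| <= B) ->
  `|\int[@lebesgue_measure R]_(x in `[a, b]) f x| <= B * (b - a).
Proof.
move=> ab fi fB; have cB : lebesgue_measure.-integrable `[a, b] (EFin \o cst B).
  by apply: continuous_integrable_itv => x; exact: cvg_cst.
apply: (le_trans (le_normr_Rintegral _ fi)) => //.
apply: (@le_trans _ _ (\int[@lebesgue_measure R]_(x in `[a, b]) B)).
  exact: (le_Rintegral _ (integrable_norm fi) cB).
rewrite Rintegral_cst//= lebesgue_measure_itv /= lte_fin.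
by case: ltgtP ab => // -> _; rewrite subrr.
Qed.

Lemma is_derive_continuous (R : realType) (F f : R -> R) :
  (forall x : R, is_derive x 1 F (f x)) -> continuous F.
Proof.
move=> dF x.
exact/differentiable_continuous/derivable1_diffP/ex_derive.
Qed.

Lemma Rintegral_derive (R : realType) (F f : R -> R) (a b : R) : a <= b ->
  continuous f -> (forall x : R, is_derive x 1 F (f x)) ->
  \int[@lebesgue_measure R]_(x in `[a, b]) f x = F b - F a.
Proof.
rewrite le_eqVlt => /predU1P[<- _ _|ab cf dF].
  by rewrite set_itv1 Rintegral_set1 subrr.
have cF := is_derive_continuous dF.
rewrite /Rintegral (continuous_FTC2 ab _ (F := F))//.
- exact: continuous_subspaceT.
- split; first by move=> x _; exact: ex_derive.
  + by apply: cvg_at_right_filter; exact: cF.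
  + by apply: cvg_at_left_filter; exact: cF.
- by move=> x _; rewrite derive1E; exact: derive_val.
Qed.

Lemma is_derive_lipschitz (R : realType) (F f : R -> R) (B : R) :
  (forall x : R, is_derive x 1 F (f x)) -> (forall x, `|f x| <= B) ->
  forall x y, `|F x - F y| <= B * `|x - y|.
Proof.
move=> dF fB x y; wlog yx : x y / y <= x.
  move=> H; case: (leP y x) => [/H//|/ltW /H].
  by rewrite distrC [`|x - y|]distrC.
have [c _ ->] := MVT_segment yx (fun z _ => dF z)
  (continuous_subspaceT (is_derive_continuous dF)).
by rewrite normrM ler_wpM2r.
Qed.

Lemma exists_primitive (R : realType) (f : R -> R) : continuous f ->
  exists F : R -> R, forall x : R, is_derive x 1 F (f x).
Proof.
move=> cf; have fi a b := continuous_integrable_itv a b cf.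
pose I (a b : R) := \int[@lebesgue_measure R]_(x in `[a, b]) f x.
exists (fun x => if 0 <= x then I 0 x else - I x 0) => x.
(* A base point strictly below both 0 and x: near x, both branches of the witness equal
   [I a y - I a 0], and x is interior to [[a, x + 1]], where the fundamental theorem applies. *)
pose a : R := - `|x| - 1.
have ax : a < x by rewrite /a; have := ler_norm (- x); rewrite normrN; lra.
have a0 : a < 0 by rewrite /a; have := normr_ge0 x; lra.
have xx1 : x < x + 1 by rewrite ltrDl.
have [dG GE] := continuous_FTC1_closed xx1 (fi a (x + 1)) ax (cf x).
rewrite -/(I a) derive1E in dG GE.
have dI : is_derive x 1 (I a) (f x) by split.
apply: (near_eq_is_derive (f := fun y => I a y + - I a 0)); last first.
  by rewrite -[f x]addr0; apply: is_derive1D; exact: is_derive_cst.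
near=> y; have ay : a < y by near: y; exact: lt_nbhsr.
case: leP => y0.
  by rewrite /I (Rintegral_itv_split (ltW a0) y0 (fi _ _)) addrAC subrr add0r.
by rewrite /I (Rintegral_itv_split (ltW ay) (ltW y0) (fi _ _)) opprD addrA subrr add0r.
Unshelve. all: by end_near. Qed.

Lemma periodic_intmul (R : realType) (V : Type) (f : R -> V) :
  (forall x, f (x + 1) = f x) -> forall (n : int) x, f (x + n%:~R) = f x.
Proof.
move=> f1; have fn (n : nat) x : f (x + n%:R) = f x.
  elim: n x => [|n ih] x; first by rewrite addr0.
  by rewrite -addn1 natrD addrA f1.
case=> n x; first exact: fn.
by rewrite NegzE mulrNz -[LHS](fn n.+1) subrK.
Qed.

Lemma periodic_reduce (R : realType) (V : Type) (f : R -> V) x :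
  (forall x, f (x + 1) = f x) -> exists2 y, 0 <= y <= 1 & f x = f y.
Proof.
move=> f1; exists (x - (Num.floor x)%:~R); last first.
  by rewrite -mulrNz periodic_intmul.
have := ge_floor x; have := floorD1_gt x; rewrite intrD mulr1z => ? ?.
by apply/andP; split; lra.
Qed.

(** Mean zero of f makes the primitive periodic; choosing the primitive of mean zero keeps the bound
    B unchanged, so the construction can be iterated at no cost. *)
Lemma periodic_primitive (R : realType) (f : R -> R) (B : R) :
  continuous f -> (forall x, f (x + 1) = f x) ->
  \int[@lebesgue_measure R]_(x in `[0, 1]) f x = 0 ->
  (forall x, `|f x| <= B) ->
  exists F : R -> R, [/\ forall x : R, is_derive x 1 F (f x),
    forall x, F (x + 1) = F x,
    \int[@lebesgue_measure R]_(x in `[0, 1]) F x = 0 &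
    forall x, `|F x| <= B].
Proof.
move=> cf f1 f0 fB; have [F0 dF0] := exists_primitive cf.
pose c := \int[@lebesgue_measure R]_(x in `[0, 1]) F0 x.
pose F x := F0 x + - c.
have dF (x : R) : is_derive x 1 F (f x).
  by rewrite -[f x]addr0; apply: is_derive1D; exact: is_derive_cst.
have cF := is_derive_continuous dF.
(* F (x + 1) - F x has derivative zero, so it equals its value at 0, which is the vanishing integral
   of f over the period. *)
have F1 x : F (x + 1) = F x.
  have dD (y : R) : is_derive y 1 (fun z => F (z + 1) + -1 * F z) 0.
    have d1 : is_derive y 1 (fun z => F (z + 1)) (f (y + 1)).
      have dS : is_derive y 1 (fun z : R => z + 1) 1 by exact: is_derive_shift.
      by have := @is_derive1_comp R F (fun z => z + 1) y _ _ (dF _) dS; rewrite mulr1.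
    have d2 : is_derive y 1 (fun z => -1 * F z) (- f y).
      have := is_derive1M (is_derive_cst (-1 : R) y 1) (dF y).
      by rewrite mul0r add0r mulN1r.
    by have := is_derive1D d1 d2; rewrite f1 subrr.
  have := is_derive_0_is_cst x 0 dD.
  rewrite !mulN1r add0r -(Rintegral_derive ler01 cf dF) f0.
  by move/eqP; rewrite subr_eq0 => /eqP.
have F01 : \int[@lebesgue_measure R]_(x in `[0, 1]) F x = 0.
  rewrite RintegralD//=.
  - by rewrite Rintegral_cst//= lebesgue_measure_itv/= lte_fin ltr01 oppr0 adde0 mulr1 subrr.
  - by apply: continuous_integrable_itv; exact: is_derive_continuous dF0.
  - by apply: continuous_integrable_itv => x; exact: cvg_cst.
exists F; split => // x.
have [y y01 ->] := periodic_reduce x F1; clear x.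
have iF : lebesgue_measure.-integrable `[0, 1] (EFin \o F).
  exact: continuous_integrable_itv.
have icst : lebesgue_measure.-integrable `[0, 1] (EFin \o cst (F y)).
  by apply: continuous_integrable_itv => x; exact: cvg_cst.
(* F has mean zero, so F y is the average of F y - F x over the cell. F is B-Lipschitz and |y - x|
   <= 1 there. *)
have -> : F y = \int[@lebesgue_measure R]_(x in `[0, 1]) (F y - F x).
  rewrite RintegralB//= F01 subr0 Rintegral_cst//= lebesgue_measure_itv/=.
  by rewrite lte_fin ltr01 oppr0 adde0 mulr1.
rewrite -[B]mulr1 -[X in _ <= B * X]subr0; apply: ler_norm_Rintegral_itv => //.
  by have := integrableB _ icst iF; exact.
move=> x /andP[x0 x1]; apply: (le_trans (is_derive_lipschitz dF fB y x)).
have B0 : 0 <= B by exact: le_trans (normr_ge0 _) (fB 0).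
rewrite ler_piMr// ler_norml; case/andP: y01 => y0 y1.
by apply/andP; split; lra.
Qed.

(** * Smooth approximation of periodic functions *)

Lemma lipschitz_continuous (R : realType) (f : R -> R) (L : R) :
  (forall x y, `|f x - f y| <= L * `|x - y|) -> continuous f.
Proof.
move=> fL x; apply/cvgrPdist_le => e e0.
have L0 : 0 < `|L| + 1 by rewrite ltr_wpDl.
near=> y; apply: (le_trans (fL x y)).
apply: (@le_trans _ _ ((`|L| + 1) * `|x - y|)).
  by rewrite ler_wpM2r// (le_trans (ler_norm L))// lerDl.
rewrite -ler_pdivlMl//; near: y.
by apply: cvgr_dist_le => //; rewrite mulr_gt0// invr_gt0.
Unshelve. all: by end_near. Qed.

Lemma cos_turn_periodic (R : realType) (x : R) :
  cos (pi *+ 2 * (x + 1)) = cos (pi *+ 2 * x).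
Proof. by rewrite mulrDr mulr1 cosD2pi. Qed.

Lemma lt_cos_turn (R : realType) (a b : R) : 0 <= a -> a < b -> b <= 1 / 2 ->
  cos (pi *+ 2 * b) < cos (pi *+ 2 * a).
Proof.
have p0 := pi_gt0 R; have p2 : 0 < pi *+ 2 :> R by rewrite mulrn_wgt0.
have in0pi (x : R) : 0 <= x -> x <= 1 / 2 -> pi *+ 2 * x \in `[0, pi]%R.
  move=> x0 x2; rewrite in_itv/=; apply/andP; split; first by apply: mulr_ge0; rewrite ?(ltW p2).
  by rewrite -[leRHS]mulr1 mulrnAl -mulrnAr ler_pM2l// mulr2n; lra.
move=> a0 ab b2; have a2 := le_trans (ltW ab) b2; have b0 := le_trans a0 (ltW ab).
by rewrite ltr_cos ?in0pi// ltr_pM2l.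
Qed.

Lemma le_cos_turn (R : realType) (a b : R) : 0 <= a -> a <= b -> b <= 1 / 2 ->
  cos (pi *+ 2 * b) <= cos (pi *+ 2 * a).
Proof.
move=> a0; rewrite le_eqVlt => /predU1P[->//|ab] b2.
exact/ltW/lt_cos_turn.
Qed.

(** The fractional part y of x satisfies both e <= y and e <= 1 - y, by comparison with the two
    neighbouring integers. On the right half of the period, reflecting y to 1 - y returns to the
    interval where the cosine decreases. *)
Lemma cos_turn_far (R : realType) (e x : R) : 0 <= e ->
  (forall k : int, e <= `|x - k%:~R|) -> cos (pi *+ 2 * x) <= cos (pi *+ 2 * e).
Proof.
move=> e0 far; set n := Num.floor x; pose y := x - n%:~R.
have -> : cos (pi *+ 2 * x) = cos (pi *+ 2 * y).
  by rewrite /y -mulrNz (periodic_intmul (@cos_turn_periodic R)).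
have y0 : 0 <= y by rewrite subr_ge0 ge_floor.
have y1 : y <= 1 by rewrite lerBlDl; have := floorD1_gt x; rewrite intrD mulr1z => /ltW.
have ey : e <= y by have := far n; rewrite ger0_norm.
have ey1 : e <= 1 - y.
  have := far (n + 1)%R; rewrite intrD mulr1z distrC (_ : _ - x = 1 - y).
    by rewrite ger0_norm ?subr_ge0.
  by rewrite /y; ring.
have [y2|y2] := leP y (1 / 2); first exact: le_cos_turn.
rewrite -cosN (_ : - _ = pi *+ 2 * ((- y + 1) + (-1)%:~R)); last first.
  by rewrite mulrN1z addrK mulrN.
rewrite (periodic_intmul (@cos_turn_periodic R)).
by apply: le_cos_turn => //; lra.
Qed.

(* A partition of unity with the positive weights [expR (A * cos (2 * pi * (x -
   j / N)))]: for large A they concentrate on the nodes j / N nearest to x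
   modulo 1. *)
Lemma periodic_approx (R : realType) (f : R -> R) (L d : R) : 0 < d ->
  (forall x y, `|f x - f y| <= L * `|x - y|) -> (forall x, f (x + 1) = f x) ->
  exists g, [/\ smooth g, forall x, g (x + 1) = g x & forall x, `|f x - g x| <= d].
Proof.
(* A Lipschitz constant enlarged to be positive and at least d, so that the radius [e] below does
   not exceed 1/2. *)
move=> d0 fL0 f1; pose M := `|L| + d + 1.
have Mge : 0 < M by rewrite /M; have := normr_ge0 L; lra.
have fL x y : `|f x - f y| <= M * `|x - y|.
  apply: (le_trans (fL0 x y)); rewrite ler_wpM2r//.
  by rewrite /M; have := ler_norm L; lra.
have dM : d <= M by rewrite /M; have := normr_ge0 L; lra.
(* Within distance e the function varies by at most d / 2. The mesh 1/N is then taken at most e / 2,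
   so that some node lies well inside this radius. *)
clearbody M; pose e := d / 2 / M.
have e0 : 0 < e by rewrite /e !divr_gt0.
have Me : M * e = d / 2 by rewrite /e mulrCA divff ?mulr1 ?gt_eqF.
have e2 : e <= 1 / 2 by rewrite /e ler_pdivrMr// mulrAC mul1r ler_pM2r.
clearbody e; pose N := (Num.truncn (2 / e)).+1.
have N0 : 0 < N%:R :> R by rewrite ltr0n.
have Ne : N%:R^-1 <= e / 2.
  rewrite -[e / 2]invf_div lef_pV2 ?posrE ?divr_gt0//.
  exact/ltW/truncnS_gt.
(* The gap between the cosines at distances e / 2 and e. [A] is tuned so that A c = (N + 1) M / (d /
   2); since exp (A c) >= A c, one near weight outweighs all N + 1 far ones. *)
clearbody N; pose c := cos (pi *+ 2 * (e / 2)) - cos (pi *+ 2 * e).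
have c0 : 0 < c by rewrite subr_gt0; apply: lt_cos_turn => //; lra.
pose A := N.+1%:R * M / (d / 2) / c.
have A0 : 0 < A by rewrite /A !divr_gt0// mulr_gt0// ltr0n.
pose w (j : 'I_N.+1) x := expR (A * cos (pi *+ 2 * (x + - (j%:R / N%:R)))).
have w0 j x : 0 < w j x by exact: expR_gt0.
have w1 j x : w j (x + 1) = w j x.
  by rewrite /w addrAC cos_turn_periodic.
have sw j : smooth (w j).
  apply: (smooth_comp (smooth_expR R)).
  apply: smooth_scale.
  apply: (smooth_comp (smooth_cos R)).
  apply: smooth_scale.
  by apply: smooth_add; [exact: smooth_id|exact: smooth_cst].
pose W x := \sum_(j < N.+1) w j x.
have W0 x : 0 < W x.
  by rewrite /W big_ord_recl ltr_pwDl// sumr_ge0// => j _; exact: ltW.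
pose g x := (\sum_(j < N.+1) f (j%:R / N%:R) * w j x) * (W x)^-1.
have g1 x : g (x + 1) = g x.
  rewrite /g /W; congr (_ * _^-1); last by apply: eq_bigr => j _.
  by apply: eq_bigr => j _; rewrite w1.
exists g; split=> //.
  apply: smooth_mul.
    by apply: smooth_sum => j; exact: smooth_scale.
  apply: smooth_inv => [|x]; first by apply: smooth_sum.
  by rewrite gt_eqF.
move=> x0; have fg1 x : f (x + 1) - g (x + 1) = f x - g x by rewrite f1 g1.
have [x /andP[xge0 xle1] ->] := periodic_reduce x0 fg1.
have osc y : `|f x - f y| <= M.
  have [z /andP[z0 z1] ->] := periodic_reduce y f1.
  apply: (le_trans (fL _ _)); rewrite ler_piMr ?(ltW Mge)// ler_norml.
  by apply/andP; split; lra.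
pose Ee := expR (A * cos (pi *+ 2 * e)).
(* Either the node value is within d / 2 of f x, or the node is at distance at least e from x modulo
   1 and its weight is at most [Ee]. *)
have term (j : 'I_N.+1) :
    `|f x - f (j%:R / N%:R)| * w j x <= d / 2 * w j x + M * Ee.
  have [near|far] := leP `|f x - f (j%:R / N%:R)| (d / 2).
    by rewrite -[leLHS]addr0 lerD ?ler_wpM2r ?(ltW (w0 _ _))// mulr_ge0 ?expR_ge0// ltW.
  rewrite -[leLHS]add0r lerD//; first by rewrite mulr_ge0 ?ltW// divr_gt0.
  rewrite ler_pM ?(ltW (w0 _ _))// /w ler_expR ler_wpM2l ?(ltW A0)//.
  apply: cos_turn_far => [|k]; first exact: ltW.
  rewrite leNgt; apply/negP => H; move: far; apply/negP; rewrite -leNgt.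
  rewrite -(periodic_intmul f1 k (j%:R / N%:R)) (le_trans (fL _ _))//.
  by rewrite -Me ler_pM2l// opprD addrA ltW.
(* The witness is the node just to the left of x, at distance at most 1/N <= e / 2. Both 0 and 1 are
   nodes, so x = 1 is covered, with j = N. *)
have [j0 j0P] : exists j : 'I_N.+1, expR (A * cos (pi *+ 2 * (e / 2))) <= w j x.
  have xN : 0 <= x * N%:R by rewrite mulr_ge0// ltW.
  have jlt : (Num.truncn (x * N%:R) < N.+1)%N.
    rewrite ltnS truncn_le_nat (le_lt_trans (_ : _ <= N%:R))//.
      by rewrite ler_piMl// ltW.
    by rewrite ltr_nat.
  exists (Ordinal jlt); rewrite /w ler_expR ler_wpM2l ?(ltW A0)//=.
  have /andP[t1 t2] := truncn_itv xN.
  set t := (Num.truncn _)%:R in t1 *; have {}t2 : x * N%:R < t + 1.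
    by move: t2; rewrite -natr1.
  have tx : t / N%:R <= x by rewrite ler_pdivrMr.
  have xt : x <= t / N%:R + N%:R^-1.
    by rewrite -[X in _ + X]div1r -mulrDl ler_pdivlMr// ltW.
  by apply: le_cos_turn; lra.
have small : N.+1%:R * (M * Ee) <= d / 2 * W x.
  have wW : w j0 x <= W x.
    rewrite /W (bigD1 j0)//= lerDl sumr_ge0// => j _; exact: ltW.
  apply: (@le_trans _ _ (d / 2 * w j0 x)); last by rewrite ler_wpM2l// ltW// divr_gt0.
  apply: (@le_trans _ _ (d / 2 * expR (A * cos (pi *+ 2 * (e / 2))))); last first.
    by rewrite ler_wpM2l// ltW// divr_gt0.
  rewrite (_ : A * cos (pi *+ 2 * (e / 2)) = A * cos (pi *+ 2 * e) + A * c); last first.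
    by rewrite -mulrDr /c addrC subrK.
  rewrite expRD -/Ee [leRHS]mulrCA mulrA [leLHS]mulrC ler_pM2l ?expR_gt0//.
  rewrite -ler_pdivrMl ?divr_gt0//.
  apply: (@le_trans _ _ (A * c)); last first.
    by apply: le_trans (expR_ge1Dx _); rewrite lerDr.
  by rewrite /A divfK ?gt_eqF// mulrC.
have -> : f x - g x = (\sum_(j < N.+1) (f x - f (j%:R / N%:R)) * w j x) / W x.
  under eq_bigr do rewrite mulrBl.
  by rewrite sumrB -mulr_sumr -/(W x) mulrBl mulfK ?gt_eqF.
rewrite normrM normfV (gtr0_norm (W0 x)) ler_pdivrMr//.
apply: (le_trans (ler_norm_sum _ _ _)).
apply: (@le_trans _ _ (\sum_(j < N.+1) (d / 2 * w j x + M * Ee))).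
  apply: ler_sum => j _.
  by rewrite normrM (gtr0_norm (w0 _ _)).
rewrite big_split /= -!mulr_sumr sumr_const card_ord -[Ee *+ _]mulr_natl [M * _]mulrCA.
apply: (le_trans (lerD (lexx _) small)).
by rewrite -mulrDl -splitr.
Qed.

(** As f has mean zero, the mean of an approximant with accuracy d / 2 is at most d / 2, so
    subtracting it costs only the other half of d. *)
Lemma periodic_approx_mean0 (R : realType) (f : R -> R) (L d : R) : 0 < d ->
  (forall x y, `|f x - f y| <= L * `|x - y|) -> (forall x, f (x + 1) = f x) ->
  \int[@lebesgue_measure R]_(x in `[0, 1]) f x = 0 ->
  exists g, [/\ smooth g, forall x, g (x + 1) = g x,
    \int[@lebesgue_measure R]_(x in `[0, 1]) g x = 0 &
    forall x, `|f x - g x| <= d].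
Proof.
move=> d0 fL f1 f0; have d20 : 0 < d / 2 by rewrite divr_gt0.
have [g [sg g1 fg]] := periodic_approx d20 fL f1.
pose c := \int[@lebesgue_measure R]_(x in `[0, 1]) g x.
have cg := smooth_continuous sg; have cf := lipschitz_continuous fL.
have ig : lebesgue_measure.-integrable `[0, 1] (EFin \o g).
  exact: continuous_integrable_itv.
have cd : `|c| <= d / 2.
  have -> : c = - \int[@lebesgue_measure R]_(x in `[0, 1]) (f x - g x).
    by rewrite RintegralB ?f0 ?sub0r ?opprK//; exact: continuous_integrable_itv.
  rewrite normrN -[X in _ <= X]mulr1 -[X in _ <= _ * X]subr0.
  apply: ler_norm_Rintegral_itv => //.
  by apply: continuous_integrable_itv => x; apply: cvgB; [exact: cf|exact: cg].
exists (fun x => g x + - c); split.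
- by apply: smooth_add => //; exact: smooth_cst.
- by move=> x; rewrite g1.
- rewrite RintegralD//; last by apply: continuous_integrable_itv => x; exact: cvg_cst.
  by rewrite Rintegral_cst//= lebesgue_measure_itv/= lte_fin ltr01 oppr0 adde0 mulr1 subrr.
- move=> x; rewrite opprD opprK addrA (le_trans (ler_normD _ _))//.
  by rewrite [leRHS]splitr lerD.
Qed.

(** * Oscillating integrals *)

Lemma measurable_le_integrable_itv (R : realType) (f : R -> R) (a b B : R) :
  measurable_fun `[a, b] f -> (forall x, a <= x <= b -> `|f x| <= B) ->
  (@lebesgue_measure R).-integrable `[a, b] (EFin \o f).
Proof.
move=> mf fB; apply: measurable_bounded_integrable => //.
  rewrite /= lebesgue_measure_itv/=; case: ifP => _; last exact: ltry.
  by rewrite -EFinD ltry.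
exists B; split; first exact: num_real.
by move=> y By x /=; rewrite in_itv/= => /fB/le_trans; apply; exact: ltW.
Qed.

Lemma smooth_lipschitz_itv (R : realType) (f : R -> R) (a b : R) : smooth f ->
  exists2 L, 0 <= L &
    forall x y, a <= x -> x <= y -> y <= b -> `|f x - f y| <= L * (y - x).
Proof.
move=> sf; have [f' sf' df] := smooth_derive sf.
have cf' : continuous (fun x => `|f' x|).
  by move=> x; apply: cvg_norm; exact: smooth_continuous.
have [ab|ba] := leP a b; last first.
  exists 0 => // x y ax xy yb; have := le_trans ax (le_trans xy yb).
  by rewrite leNgt ba.
have [c _ cM] := EVT_max ab (continuous_subspaceT cf').
exists `|f' c| => // x y ax xy yb.
have [z] := MVT_segment xy (fun z _ => df z)
  (continuous_subspaceT (smooth_continuous sf)).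
rewrite in_itv/= => /andP[xz zy] fE.
rewrite distrC fE normrM [`|y - x|]ger0_norm ?subr_ge0// ler_wpM2r ?subr_ge0//.
by apply: cM; rewrite in_itv/= (le_trans ax xz) (le_trans zy yb).
Qed.

(** The usual quotient of flat functions: it is 1 for |u| <= 1, where the second term of the
    denominator vanishes, and 0 for |u| >= 2, where the numerator does. Using u * u treats both ends
    at once. *)
Definition cutoff (R : realType) (u : R) : R :=
  flat_exp 0 (4 + - 1 * (u * u)) *
  (flat_exp 0 (4 + - 1 * (u * u)) + flat_exp 0 (u * u + - 1))^-1.

Lemma cutoff_den_gt0 (R : realType) (u : R) :
  0 < flat_exp 0 (4 + - 1 * (u * u)) + flat_exp 0 (u * u + - 1).
Proof.
have [h|h] := leP (u * u) 2.
  by rewrite ltr_pwDl ?flat_exp_ge0 ?flat_exp_gt0//; lra.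
by rewrite ltr_wpDl ?flat_exp_ge0 ?flat_exp_gt0//; lra.
Qed.

Lemma smooth_cutoff (R : realType) : smooth (@cutoff R).
Proof.
have sq : smooth (fun u : R => u * u) by apply: smooth_mul; exact: smooth_id.
have s1 : smooth (fun u : R => flat_exp 0 (4 + - 1 * (u * u))).
  apply: (smooth_comp (smooth_flat_exp R 0)).
  by apply: smooth_add; [exact: smooth_cst|exact: smooth_scale].
have s2 : smooth (fun u : R => flat_exp 0 (u * u + - 1)).
  apply: (smooth_comp (smooth_flat_exp R 0)).
  by apply: smooth_add => //; exact: smooth_cst.
apply: smooth_mul => //; apply: smooth_inv; first exact: smooth_add.
by move=> u; rewrite gt_eqF// cutoff_den_gt0.
Qed.

Lemma cutoff_le1 (R : realType) (u : R) : `|cutoff u| <= 1.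
Proof.
have den := cutoff_den_gt0 u.
rewrite normrM normfV (gtr0_norm den) ger0_norm ?flat_exp_ge0//.
by rewrite ler_pdivrMr// mul1r lerDl flat_exp_ge0.
Qed.

Lemma cutoff_eq1 (R : realType) (u : R) : `|u| <= 1 -> cutoff u = 1.
Proof.
move=> u1; have uu : u * u <= 1.
  by rewrite -expr2 -real_normK ?num_real// expr_le1.
have := cutoff_den_gt0 u; rewrite /cutoff [flat_exp 0 (u * u + _)]flat_exp_le0.
  by rewrite addr0 => h; rewrite divff// gt_eqF.
by rewrite subr_le0.
Qed.

Lemma cutoff_eq0 (R : realType) (u : R) : 2 <= `|u| -> cutoff u = 0.
Proof.
move=> u2; have uu : 4 <= u * u.
  rewrite -expr2 -real_normK ?num_real// expr2.
  by apply: (le_trans _ (ler_pM (ler0n _ 2) (ler0n _ 2) u2 u2)); lra.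
by rewrite /cutoff flat_exp_le0 ?mul0r// mulN1r subr_le0.
Qed.

(** The factor c is there for the induction: each derivative turns it into c * l. *)
Lemma derive1n_affine (R : realType) (f : R -> R) (c l b : R) n : smooth f ->
  derive1n n (fun u => c * f (l * u + b)) =
  fun u => c * l ^+ n * derive1n n f (l * u + b).
Proof.
elim: n f c => [|n ih] f c sf; first by apply/funext => u; rewrite expr0 mulr1.
have [f' sf' df] := smooth_derive sf.
have dl (u : R) : is_derive u 1 (fun u : R => l * u + b) l.
  have := is_derive1D (is_derive1M (is_derive_cst l u 1) (is_derive_id u 1))
    (is_derive_cst b u 1).
  by rewrite mul0r add0r mulr1 addr0.
have dfl (u : R) : is_derive u 1 (fun u : R => c * f (l * u + b))
    (c * l * f' (l * u + b)).
  have := is_derive1M (is_derive_cst c u 1) (is_derive1_comp (df _) (dl u)).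
  by rewrite mul0r add0r (mulrC _ l) mulrA.
rewrite derive1Sn.
rewrite (_ : derive1 _ = fun u => c * l * f' (l * u + b)); last first.
  by apply/funext => u; rewrite derive1E; exact: derive_val.
rewrite ih// derive1Sn (_ : derive1 f = f'); last first.
  by apply/funext => u; rewrite derive1E; exact: derive_val.
by apply/funext => u; rewrite exprS !mulrA.
Qed.

Lemma periodic_iter_primitive (R : realType) n (f : R -> R) (B : R) :
  smooth f -> (forall x, f (x + 1) = f x) ->
  \int[@lebesgue_measure R]_(x in `[0, 1]) f x = 0 ->
  (forall x, `|f x| <= B) ->
  exists F : R -> R, [/\ smooth F, derive1n n F = f,
    forall x, F (x + 1) = F x,
    \int[@lebesgue_measure R]_(x in `[0, 1]) F x = 0 &
    forall x, `|F x| <= B].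
Proof.
move=> sf f1 f0 fB; elim: n => [|n [F [sF Ff F1 F0 FB]]]; first by exists f.
have [G [dG G1 G0 GB]] := periodic_primitive (smooth_continuous sF) F1 F0 FB.
exists G; split => //; first exact: smooth_primitive dG.
rewrite derive1Sn -[RHS]Ff; congr (derive1n n _).
by apply/funext => u; rewrite derive1E; exact: derive_val.
Qed.

(** The function v is the total variation of g on [a, x], whose increments dominate those of g. An
    additive majorant of this kind can be summed over adjacent cells without loss. *)
Lemma BV_modulus (R : realType) (g : R -> R) (a b : R) : BV g -> a <= b ->
  exists v : R -> R, exists M : R,
    (forall x y, a <= x -> x <= y -> y <= b -> `|g x - g y| <= v y - v x) /\
    (forall x, a <= x <= b -> `|g x| <= M).
Proof.
move=> [C gC] ab.
pose V x := total_variation a x g.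
have Vfin x : a <= x -> V x \is a fin_num.
  move=> ax; rewrite ge0_fin_numE ?total_variation_ge0//.
  by rewrite (le_lt_trans (gC _ _ ax)) ?ltry.
have gv x y : a <= x -> x <= y -> y <= b -> `|g x - g y| <= fine (V y) - fine (V x).
  move=> ax xy yb; have ay := le_trans ax xy.
  rewrite lerBrDl -lee_fin EFinD !fineK ?Vfin// {2}/V (total_variationD _ ax xy).
  by rewrite leeD2l// distrC total_variation_ge.
exists (fun x => fine (V x)), (`|g a| + C); split => // x /andP[ax xb].
rewrite -[g x](subrK (g a)) addrC (le_trans (ler_normD _ _))// lerD2l.
have := total_variation_ge g ax => /le_trans /(_ (gC _ _ ax)).
by rewrite lee_fin.
Qed.

(* On each cell [k] has mean zero, so [G] may be replaced there by its
   oscillation. *)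
Lemma oscillating_cells (R : realType) (G w k : R -> R) (a d B : R) (N : nat) :
  0 <= d -> measurable_fun setT G -> continuous k ->
  (forall x, `|k x| <= B) ->
  (forall x, \int[@lebesgue_measure R]_(u in `[x, x + d]) k u = 0) ->
  (forall x y, a <= x -> x <= y -> y <= a + N%:R * d -> `|G x - G y| <= w y - w x) ->
  `|\int[@lebesgue_measure R]_(u in `[a, a + N%:R * d]) (G u * k u)| <=
    B * d * (w (a + N%:R * d) - w a).
Proof.
move=> d0 mG ck kB k0.
have B0 : 0 <= B by exact: le_trans (normr_ge0 _) (kB 0).
have mk : measurable_fun setT k by exact: continuous_measurable_fun.
have ik x y : lebesgue_measure.-integrable `[x, y] (EFin \o k).
  exact: continuous_integrable_itv.
elim: N => [|N ih] Gw.
  by rewrite mul0r addr0 set_itv1 Rintegral_set1 subrr mulr0 normr0.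
set b := a + N%:R * d in ih *.
have bE : a + N.+1%:R * d = b + d by rewrite /b -natr1 mulrDl mul1r addrA.
rewrite bE in Gw *.
have ab : a <= b by rewrite lerDl mulr_ge0.
have bd : b <= b + d by rewrite lerDl.
have iG : lebesgue_measure.-integrable `[a, b + d] (EFin \o (fun u => G u * k u)).
  apply: (@measurable_le_integrable_itv _ _ _ _ ((`|G a| + (w (b + d) - w a)) * B)).
    by apply: measurable_funTS; exact: measurable_funM.
  move=> x /andP[ax xb]; rewrite normrM ler_pM//.
  have wx : 0 <= w (b + d) - w x by apply: le_trans (Gw _ _ ax xb (lexx _)).
  have := Gw _ _ (lexx a) ax xb; have := ler_normB (G a) (G a - G x).
  rewrite opprB addrCA subrr addr0; lra.
rewrite (Rintegral_itv_split ab bd iG) (le_trans (ler_normD _ _))//.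
have {}ih : `|\int[@lebesgue_measure R]_(u in `[a, b]) (G u * k u)| <=
    B * d * (w b - w a).
  by apply: ih => x y ax xy yb; apply: Gw => //; exact: le_trans bd.
suff cell : `|\int[@lebesgue_measure R]_(u in `[b, b + d]) (G u * k u)| <=
    B * d * (w (b + d) - w b).
  apply: (le_trans (lerD ih cell)).
  by rewrite -mulrDr addrC addrA subrK.
have iGb : lebesgue_measure.-integrable `[b, b + d] (EFin \o (fun u => G u * k u)).
  by apply: integrableS iG => //; apply: subset_itvr; rewrite bnd_simp.
have ikb : lebesgue_measure.-integrable `[b, b + d] (EFin \o (fun u => G b * k u)).
  by apply: continuous_integrable_itv => x; apply: cvgM; [exact: cvg_cst|exact: ck].
have -> : \int[@lebesgue_measure R]_(u in `[b, b + d]) (G u * k u) =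
    \int[@lebesgue_measure R]_(u in `[b, b + d]) (G u * k u - G b * k u).
  by rewrite RintegralB//= RintegralZl//= k0 mulr0 subr0.
apply: (le_trans (ler_norm_Rintegral_itv (B := B * (w (b + d) - w b)) bd _ _)).
- by have := integrableB _ iGb ikb; exact.
(* Monotonicity of w from x to b + d is read off from the increment of G between these two
   points. *)
- move=> x /andP[bx xb]; rewrite -mulrBl normrM mulrC ler_pM// distrC.
  have := Gw _ _ (le_trans ab bx) xb (lexx _).
  have := Gw _ _ ab bx xb => h1 h2; have := normr_ge0 (G x - G (b + d)); lra.
- by rewrite [b + d]addrC addrK mulrAC.
Qed.

Lemma integrable_mul_bounded (R : realType) (f g : R -> R) (a b E : R) :
  (@lebesgue_measure R).-integrable `[a, b] (EFin \o f) ->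
  measurable_fun `[a, b] g -> (forall x, a <= x <= b -> `|g x| <= E) ->
  (@lebesgue_measure R).-integrable `[a, b] (EFin \o (fun u => f u * g u)).
Proof.
move=> fi mg gE.
have : (@lebesgue_measure R).-integrable `[a, b] ((EFin \o g) \* (EFin \o f))%E.
  apply: integrableMr => //; exists E; split; first exact: num_real.
  by move=> y Ey x /=; rewrite in_itv/= => /gE/le_trans; apply; exact: ltW.
by apply: eq_integrable => // x _ /=; rewrite -EFinM mulrC.
Qed.

Lemma test_function_cutoff (R : realType) (f : R -> R) : smooth f ->
  test_function (fun u => f u * cutoff u).
Proof.
move=> sf; split.
  by move=> n x; apply: smooth_derivable; apply: smooth_mul => //; exact: smooth_cutoff.
apply: (subclosed_compact _ (@segment_compact R (-2) 2)).
- exact: closed_closure.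
- have cI : closure (`[-2, 2]%classic : set R) = `[-2, 2]%classic.
    by apply/esym/closure_id; exact: interval_closed.
  rewrite -cI; apply: closure_subset => x /= /eqP fx; rewrite in_itv/= -ler_norml.
  rewrite leNgt; apply/negP => x2; apply: fx.
  by rewrite cutoff_eq0 ?mulr0// ltW.
Qed.

(** * Kernels against rapidly oscillating functions *)

Lemma kernel_eq0 (R : realType) p q (K : R -> R) x : kernel_class p q K ->
  ~ `[- 2^-1, 2^-1]%classic x -> K x = 0.
Proof.
move=> kK xI; apply/eqP; apply: contra_notT xI => Kx.
by apply: (kernel_supp kK); exact: subset_closure.
Qed.

Lemma kernel_measurable (R : realType) p q (K : R -> R) : kernel_class p q K ->
  measurable_fun setT K.
Proof. by case/kernel_BV => g [[[mK _ _] _ _] _]. Qed.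

Lemma kernel_integrable (R : realType) p q (K : R -> R) : kernel_class p q K ->
  (@lebesgue_measure R).-integrable `[- 2^-1, 2^-1] (EFin \o K).
Proof.
move=> kK; have mK := kernel_measurable kK.
have [g [[[_ _ iK] _ _] _]] := kernel_BV kK.
apply/integrableP; split; first by apply/measurable_EFinP; exact: measurable_funTS.
by apply: iK => //; exact: segment_compact.
Qed.

Lemma kernel_mass_itv (R : realType) p q (K : R -> R) : kernel_class p q K ->
  \int[@lebesgue_measure R]_(u in `[- 2^-1, 2^-1]) K u = 1.
Proof.
move=> kK; rewrite -[RHS](kernel_mass kK) Rintegral_mkcond; apply: eq_Rintegral => x _.
rewrite patchE; case: ifPn => // /negP xI.
by rewrite (kernel_eq0 kK)// => xI'; apply: xI; exact: mem_set.
Qed.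

(** The weak derivative identity is tested on [psi * cutoff], whose n-th derivative on the support
    of K is f (l u + b). The constant is the increment over [-2, 3] of a majorant built from K
    alone, so f enters only through B. *)
Lemma kernel_oscillation_smooth (R : realType) p q (K : R -> R) :
  kernel_class p q K -> exists2 C, 0 <= C & forall (f : R -> R) (B l b : R),
    smooth f -> (forall x, f (x + 1) = f x) ->
    \int[@lebesgue_measure R]_(x in `[0, 1]) f x = 0 ->
    (forall x, `|f x| <= B) -> 1 <= l ->
    `|\int[@lebesgue_measure R]_(u in `[- 2^-1, 2^-1]) (K u * f (l * u + b))| <=
      C * B * l^-1 ^+ (absz (q + 1)).+1.
Proof.
move=> kK; have [g [[_ [mg _ _] wKg] bvg]] := kernel_BV kK.
set n := absz (q + 1) in wKg *.
(* The cutoff lives on [-2, 2]; the extra unit leaves room for the last cell of length 1/l to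
   overshoot 2. *)
have le23 : (-2 : R) <= 3 by lra.
have [v [M [gv gM]]] := BV_modulus bvg le23.
have [L L0 cL] := smooth_lipschitz_itv (-2) 3 (smooth_cutoff R).
have M0 : 0 <= M by apply: le_trans (gM (-2) _) => //; rewrite lexx.
(* Product rule for increments: v controls g against |cutoff| <= 1, and M L controls the cutoff
   against |g| <= M. *)
pose w x := v x + M * L * x.
pose G x := g x * cutoff x.
have mG : measurable_fun setT G.
  by apply: measurable_funM => //; apply: continuous_measurable_fun;
     apply: smooth_continuous; exact: smooth_cutoff.
have Gw x y : -2 <= x -> x <= y -> y <= 3 -> `|G x - G y| <= w y - w x.
  move=> x2 xy y3.
  have -> : G x - G y = (g x - g y) * cutoff x + g y * (cutoff x - cutoff y).
    by rewrite /G; ring.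
  have -> : w y - w x = (v y - v x) * 1 + M * (L * (y - x)) by rewrite /w; ring.
  rewrite (le_trans (ler_normD _ _))// lerD// normrM ler_pM//.
  - exact: gv.
  - exact: cutoff_le1.
  - by apply: gM; rewrite y3 (le_trans x2 xy).
  - exact: cL.
have w0 : 0 <= w 3 - w (-2) by apply: le_trans (Gw _ _ (lexx _) le23 (lexx _)).
exists (w 3 - w (-2)) => // f B l b sf f1 f0 fB l1.
have l0 : 0 < l by exact: lt_le_trans l1.
have B0 : 0 <= B by exact: le_trans (normr_ge0 _) (fB 0).
have [F [sF Ff F1 F0 FB]] := periodic_iter_primitive n sf f1 f0 fB.
(* Each derivative of F (l u + b) produces a factor l, which the prefactor cancels after n of
   them. *)
pose psi u := l^-1 ^+ n * F (l * u + b).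
have spsi : smooth psi.
  apply: smooth_scale; apply: (smooth_comp sF).
  by apply: smooth_add; [apply: smooth_scale; exact: smooth_id|exact: smooth_cst].
have psin : derive1n n psi = fun u => f (l * u + b).
  rewrite derive1n_affine// Ff; apply/funext => u.
  by rewrite -exprMn mulVf ?gt_eqF// expr1n mul1r.
have := wKg _ (test_function_cutoff spsi).
have -> : \int[@lebesgue_measure R]_x
    (K x * derive1n n (fun u => psi u * cutoff u) x) =
    \int[@lebesgue_measure R]_(u in `[- 2^-1, 2^-1]) (K u * f (l * u + b)).
  rewrite [RHS]Rintegral_mkcond; apply: eq_Rintegral => x _.
  rewrite patchE; case: ifPn => [/set_mem|/negP] xI; last first.
    by rewrite (kernel_eq0 kK) ?mul0r// => xI'; apply: xI; exact: mem_set.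
  (* An open neighbourhood of the support of K on which the cutoff is identically 1. *)
  have oU : open (`]-1, 1[%classic : set R) by exact: interval_open.
  rewrite (derive1n_near n oU (g := psi)) ?psin//.
    move=> y /set_mem/=; rewrite in_itv/= => /andP[y1 y2].
    by rewrite cutoff_eq1 ?mulr1// ler_norml !ltW.
  by apply: mem_set => /=; move: xI => /=; rewrite !in_itv/= => /andP[x1 x2];
     apply/andP; split; lra.
move=> ->; rewrite normrM normrX normrN1 expr1n mul1r.
(* Enough cells to cover [-2, 2]. Their total length is at most 4 + 1/l, hence at most 5 because l
   >= 1, so they stay inside [-2, 3]. *)
pose N := (Num.truncn (4 * l)).+1.
have [N4 N5] : 4 <= N%:R * l^-1 /\ N%:R * l^-1 <= 5.
  have /andP[t1 t2] := truncn_itv (ltW (mulr_gt0 (ltr0n _ 4) l0)).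
  rewrite ler_pdivlMr// ler_pdivrMr// (ltW t2); split=> //.
  rewrite /N -natr1 (_ : 5 * l = 4 * l + l); last by ring.
  exact: lerD.
pose k u := F (l * u + b).
have ck : continuous k.
  apply: smooth_continuous; apply: (smooth_comp sF).
  by apply: smooth_add; [apply: smooth_scale; exact: smooth_id|exact: smooth_cst].
(* The cell length 1/l is a period of k, and the primitive P (l u + b) / l takes the same value at
   both ends because P is itself periodic. *)
have k0 x : \int[@lebesgue_measure R]_(u in `[x, x + l^-1]) k u = 0.
  have [P [dP P1 _ _]] := periodic_primitive (smooth_continuous sF) F1 F0 FB.
  have dlP (u : R) : is_derive u 1 (fun u => l^-1 * P (l * u + b)) (k u).
    have dl : is_derive u 1 (fun u : R => l * u + b) l.
      have := is_derive1D (is_derive1M (is_derive_cst l u 1) (is_derive_id u 1))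
        (is_derive_cst b u 1).
      by rewrite mul0r add0r mulr1 addr0.
    have := is_derive1M (is_derive_cst l^-1 u 1) (is_derive1_comp (dP _) dl).
    by rewrite mul0r add0r (mulrC _ l) mulrA mulVf ?gt_eqF// mul1r.
  rewrite (Rintegral_derive _ ck dlP) ?lerDl ?invr_ge0 ?ltW//.
  by rewrite mulrDr divff ?gt_eqF// addrAC P1 subrr.
have -> : \int[@lebesgue_measure R]_x (g x * (psi x * cutoff x)) =
    l^-1 ^+ n * \int[@lebesgue_measure R]_(u in `[-2, -2 + N%:R * l^-1]) (G u * k u).
  rewrite -RintegralZl//; last first.
    apply: (@measurable_le_integrable_itv _ _ _ _ (M * 1 * B)).
      by apply: measurable_funTS; apply: measurable_funM => //;
         exact: continuous_measurable_fun.
    move=> x /andP[x2 x3]; rewrite normrM ler_pM//; last exact: FB.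
    rewrite normrM ler_pM// ?cutoff_le1//; apply: gM; rewrite x2.
    by apply: (le_trans x3); lra.
  rewrite [RHS]Rintegral_mkcond; apply: eq_Rintegral => x _.
  rewrite patchE; case: ifPn => [_|/negP xI]; first by rewrite /G /psi /k; ring.
  rewrite cutoff_eq0 ?mulr0// leNgt; apply/negP; rewrite ltr_norml => /andP[x2 x3].
  apply: xI; apply: mem_set => /=; rewrite in_itv/= ltW//= ltW//.
  by apply: (lt_le_trans x3); lra.
rewrite normrM normrX normfV (gtr0_norm l0).
have GN x y : -2 <= x -> x <= y -> y <= -2 + N%:R * l^-1 -> `|G x - G y| <= w y - w x.
  by move=> x2 xy yN; apply: Gw => //; apply: (le_trans yN); lra.
have kB x : `|k x| <= B by exact: FB.
have linv : 0 <= l^-1 by rewrite invr_ge0 ltW.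
have cells := oscillating_cells linv mG ck kB k0 GN.
have wN : w (-2 + N%:R * l^-1) - w (-2) <= w 3 - w (-2).
  rewrite lerD2r -subr_ge0; apply: le_trans (Gw _ _ _ _ (lexx _)) => //; lra.
apply: (le_trans (ler_wpM2l (exprn_ge0 n linv) cells)).
rewrite exprS [leRHS]mulrA [leRHS]mulrC ler_wpM2l ?exprn_ge0//.
rewrite [leRHS](_ : _ = B * l^-1 * (w 3 - w (-2))); last by ring.
by rewrite ler_wpM2l// mulr_ge0.
Qed.

(** The smooth estimate applied to an approximant within d' of f has B + d' in place of B and
    nothing else new; the remainder is at most d' times the L1 norm of K. Since d is arbitrary, the
    bound survives, without L in it. *)
Lemma kernel_oscillation (R : realType) p q (K : R -> R) :
  kernel_class p q K -> exists2 C, 0 <= C & forall (f : R -> R) (L B l b : R),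
    (forall x y, `|f x - f y| <= L * `|x - y|) -> (forall x, f (x + 1) = f x) ->
    \int[@lebesgue_measure R]_(x in `[0, 1]) f x = 0 ->
    (forall x, `|f x| <= B) -> 1 <= l ->
    `|\int[@lebesgue_measure R]_(u in `[- 2^-1, 2^-1]) (K u * f (l * u + b))| <=
      C * B * l^-1 ^+ (absz (q + 1)).+1.
Proof.
move=> kK; have [C C0 osc] := kernel_oscillation_smooth kK.
have iK := kernel_integrable kK; have mK := kernel_measurable kK.
exists C => // f L B l b fL f1 f0 fB l1.
have l0 : 0 < l by exact: lt_le_trans l1.
pose I := \int[@lebesgue_measure R]_(u in `[- 2^-1, 2^-1]) `|K u|.
have I0 : 0 <= I by apply: Rintegral_ge0 => x _.
set e := l^-1 ^+ _; have e1 : e <= 1.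
  by rewrite /e exprn_ile1// ?invr_ge0 ?invf_le1// ltW.
have e0 : 0 <= e by rewrite exprn_ge0// invr_ge0 ltW.
apply/ler_addgt0Pr => d d0.
(* The total error is C d' e + I d' with e <= 1; the added 1 keeps the denominator positive. *)
pose d' := d / (C + I + 1); have CI : 0 < C + I + 1 by lra.
have d'0 : 0 < d' by rewrite divr_gt0.
have [h [sh h1 h0 fh]] := periodic_approx_mean0 d'0 fL f1 f0.
have hB x : `|h x| <= B + d'.
  have := ler_normB (f x) (f x - h x); rewrite opprB addrCA subrr addr0.
  by have := fh x; have := fB x; lra.
have {}osc := osc _ _ _ b sh h1 h0 hB l1.
have iM (r : R -> R) (E : R) : continuous r -> (forall x, `|r x| <= E) ->
    (@lebesgue_measure R).-integrable `[- 2^-1, 2^-1] (EFin \o (fun u => K u * r (l * u + b))).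
  move=> cr rE.
  have cra : continuous (fun u => r (l * u + b)).
    move=> u; apply: (@continuous_comp _ _ _ (fun u => l * u + b) r); last exact: cr.
    by apply: cvgD; [apply: cvgM; [exact: cvg_cst|exact: cvg_id]|exact: cvg_cst].
  have mra := continuous_measurable_fun cra.
  apply: (integrable_mul_bounded (E := E) iK); last by move=> x _; exact: rE.
  exact: measurable_funTS.
have cf := lipschitz_continuous fL; have ch := smooth_continuous sh.
have cfh : continuous (fun x => f x - h x) by move=> x; apply: cvgB; [exact: cf|exact: ch].
have -> : \int[@lebesgue_measure R]_(u in `[- 2^-1, 2^-1]) (K u * f (l * u + b)) =
   \int[@lebesgue_measure R]_(u in `[- 2^-1, 2^-1]) (K u * h (l * u + b)) +
   \int[@lebesgue_measure R]_(u in `[- 2^-1, 2^-1]) (K u * (f (l * u + b) - h (l * u + b))).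
  rewrite -RintegralD//; [|exact: iM hB|exact: (iM (fun x => f x - h x) d')].
  by apply: eq_Rintegral => u _; rewrite -mulrDr [h _ + _]addrC subrK.
have rest : `|\int[@lebesgue_measure R]_(u in `[- 2^-1, 2^-1])
    (K u * (f (l * u + b) - h (l * u + b)))| <= I * d'.
  have iKfh := iM (fun x => f x - h x) d' cfh fh.
  apply: (le_trans (le_normr_Rintegral _ iKfh)) => //.
  rewrite /I -RintegralZr//; last exact: (integrable_norm iK).
  apply: le_Rintegral => //.
  - exact: (integrable_norm iKfh).
  - by have := integrableZr _ d' (integrable_norm iK); exact.
  - by move=> u _; rewrite normrM ler_wpM2l.
apply: (le_trans (ler_normD _ _)); apply: (le_trans (lerD osc rest)).
have Cd : C * d' * e <= C * d' by rewrite ler_piMr// mulr_ge0// ltW.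
have dE : (C + I + 1) * d' = d by rewrite /d' mulrCA divff ?mulr1// gt_eqF.
rewrite -/e mulrDr mulrDl; nra.
Qed.

(** * Derivatives relative to an interval *)

Lemma within_dnbhs_cvg_near (R : realType) (V : normedModType R) (A : set R)
    (f : R -> V) (x : R) (l : V) (e : R) :
  diffquot_within A f x --> l -> 0 < e ->
  \forall u \near x, u != x -> A u -> `|l - (u - x)^-1 *: (f u - f x)| <= e.
Proof. by move=> /cvgrPdist_le H e0; exact: H. Qed.

Lemma is_derive_within_itv (R : realType) (f : R -> R) (a b x l : R) :
  a < x < b -> diffquot_within `[a, b] f x --> l -> is_derive x 1 f l.
Proof.
move=> /andP[ax xb] fl.
have H : h^-1 *: (f (h *: 1 + x) - f x) @[h --> 0^'] --> (l : R).
  apply/cvgrPdist_le => e e0.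
  have Q : \forall u \near x, u != x -> `|l - (u - x)^-1 *: (f u - f x)| <= e.
    near=> u => ux; move: ux.
    have : `[a, b]%classic u.
      rewrite /= in_itv/=; apply/andP; split; apply/ltW.
        by near: u; exact: lt_nbhsr.
      by near: u; exact: lt_nbhsl.
    move=> uab ux; move: ux uab; near: u; exact: within_dnbhs_cvg_near.
  move/nbhs_ballP : Q => [d /= d0 dQ].
  near=> h.
  have h0 : h != 0 by near: h; exact: nbhs_dnbhs_neq.
  have hd : `|h| < d by near: h; exact: dnbhs0_lt.
  have := dQ (h + x); rewrite -ball_normE/= opprD addrCA subrr addr0 normrN => /(_ hd).
  by rewrite -subr_eq0 addrK [h *: 1]mulr1; exact.
split; first by apply/cvg_ex; exists l; exact: H.
exact: (@cvg_lim R^o).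
Unshelve. all: by end_near. Qed.

Lemma within_derivable_continuous (R : realType) (f df : R -> R) (A : set R) :
  (forall x, A x -> diffquot_within A f x --> df x) -> {within A, continuous f}.
Proof.
move=> fd; apply/subspace_continuousP => x Ax; apply/cvgrPdist_le => e e0.
have L0 : 0 < `|df x| + 1 by rewrite ltr_wpDl.
have := within_dnbhs_cvg_near (fd _ Ax) ltr01.
move=> Q.
have D : \forall u \near x, `|x - u| <= e / (`|df x| + 1).
  by have /cvgrPdist_le := @cvg_id _ (nbhs x); apply; rewrite divr_gt0.

suff H : \forall u \near x, A u -> `|f x - f u| <= e by exact: H.
near=> u => Au.
have [->|ux] := eqVneq u x; first by rewrite subrr normr0 ltW.
have ux0 : 0 < `|u - x| by rewrite normr_gt0 subr_eq0.
have q1 : `|df x - (u - x)^-1 *: (f u - f x)| <= 1.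
  by move: ux Au; near: u; exact: Q.
have q2 : `|(u - x)^-1 *: (f u - f x)| <= `|df x| + 1.
  rewrite -[X in `|X|](subKr (df x)) (le_trans (ler_normB _ _))// lerD2l.
  by [].
have ue : `|u - x| <= e / (`|df x| + 1).
  by rewrite distrC; near: u; exact: D.
rewrite distrC; move: q2; rewrite normrZ normfV ler_pdivrMl// => /le_trans; apply.
by rewrite -ler_pdivlMr.
Unshelve. all: by end_near. Qed.

(** The mean value theorem needs ordinary derivatives in the interior only; at the endpoints the
    one-sided derivatives supply continuity. *)
Lemma within_derive_lipschitz (R : realType) (f df : R -> R) (a b C : R) :
  (forall x, `[a, b]%classic x -> diffquot_within `[a, b] f x --> df x) ->
  (forall x, `[a, b]%classic x -> `|df x| <= C) ->
  forall x y, a <= x <= b -> a <= y <= b -> `|f x - f y| <= C * `|x - y|.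
Proof.
move=> fd dfC x y; wlog yx : x y / y <= x.
  move=> H xab yab; case: (leP y x) => [yx|/ltW xy]; first exact: H.
  by rewrite distrC [`|x - y|]distrC; exact: H.
move=> /andP[ax xb] /andP[ay yb].
have cf : {within `[y, x], continuous f}.
  apply: continuous_subspaceW (within_derivable_continuous fd).
  by apply: subset_itv; rewrite bnd_simp.
have df' z : z \in `]y, x[%R -> is_derive z 1 f (df z).
  rewrite in_itv/= => /andP[yz zx].
  have az : a < z by exact: le_lt_trans yz.
  have zb : z < b by exact: lt_le_trans xb.
  apply: (@is_derive_within_itv _ _ a b); first by rewrite az.
  by apply: fd; rewrite /= in_itv/= !ltW.
have [c] := MVT_segment yx df' cf.
rewrite in_itv/= => /andP[yc cx] ->.
rewrite normrM ler_wpM2r//; apply: dfC.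
by rewrite /= in_itv/= (le_trans ay yc) (le_trans cx xb).
Qed.

Lemma lipschitz_within_continuous (R : realType) (f : R -> R) (a b L : R) :
  (forall x y, a <= x <= b -> a <= y <= b -> `|f x - f y| <= L * `|x - y|) ->
  {within `[a, b], continuous f}.
Proof.
move=> fL; apply/subspace_continuousP => x /=; rewrite in_itv/= => xab.
apply/cvgrPdist_le => e e0.
have L0 : 0 < `|L| + 1 by rewrite ltr_wpDl.
have D : \forall u \near x, `|x - u| <= e / (`|L| + 1).
  by have /cvgrPdist_le := @cvg_id _ (nbhs x); apply; rewrite divr_gt0.
suff H : \forall u \near x, `[a, b]%classic u -> `|f x - f u| <= e by exact: H.
near=> u => uab.
apply: (le_trans (fL _ _ xab _)); first by move: uab; rewrite /= in_itv.
apply: (@le_trans _ _ ((`|L| + 1) * `|x - u|)).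
  by rewrite ler_wpM2r// (le_trans (ler_norm L))// lerDl.
rewrite -ler_pdivlMl// mulrC; near: u; exact: D.
Unshelve. all: by end_near. Qed.

Lemma lipschitz_measurable_itv (R : realType) (f : R -> R) (a b L : R) :
  (forall x y, a <= x <= b -> a <= y <= b -> `|f x - f y| <= L * `|x - y|) ->
  measurable_fun `[a, b] f.
Proof.
move=> /lipschitz_within_continuous cf.
exact: subspace_continuous_measurable_fun.
Qed.

(** From x to y, pass through the first integer after x and the last one before y. f takes the value
    f 0 at both, so the stretch between them contributes nothing and L is preserved even if f has
    corners at the integers. *)
Lemma periodic_lipschitz (R : realType) (f : R -> R) (L : R) : 0 <= L ->
  (forall x, f (x + 1) = f x) ->
  (forall x y, 0 <= x <= 1 -> 0 <= y <= 1 -> `|f x - f y| <= L * `|x - y|) ->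
  forall x y, `|f x - f y| <= L * `|x - y|.
Proof.
move=> L0 f1 fL.
have cell (n : int) x y : n%:~R <= x -> x <= n%:~R + 1 ->
    n%:~R <= y -> y <= n%:~R + 1 -> `|f x - f y| <= L * `|x - y|.
  move=> nx xn ny yn.
  have E z : f z = f (z - n%:~R) by rewrite -mulrNz periodic_intmul.
  rewrite (E x) (E y) (_ : x - y = (x - n%:~R) - (y - n%:~R)); last by ring.
  by apply: fL; apply/andP; split; lra.
have fi (n : int) : f n%:~R = f 0 by rewrite -[n%:~R]add0r periodic_intmul.
move=> x y; wlog xy : x y / x <= y.
  move=> H; case: (leP x y) => [/H//|/ltW /H].
  by rewrite distrC [`|x - y|]distrC.
have x1 := ge_floor x; have x2 := floorD1_gt x.
have y1 := ge_floor y; have y2 := floorD1_gt y.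
rewrite !intrD !mulr1z in x2 y2.
have [eq|ne] := eqVneq (Num.floor x) (Num.floor y).
  by apply: (cell (Num.floor x)); rewrite ?x1 ?(ltW x2)// eq ?y1 ?(ltW y2).
have lt : (Num.floor x + 1 <= Num.floor y)%R.
  by rewrite lezD1 lt_neqAle ne le_floor.
have ltR : (Num.floor x)%:~R + 1 <= (Num.floor y)%:~R :> R.
  by rewrite -[1 in leLHS](mulr1z 1) -intrD ler_int.
have le1 (n : int) : n%:~R <= n%:~R + 1 :> R by rewrite lerDl.
have c1 := cell _ _ _ x1 (ltW x2) (le1 _) (lexx _).
have c2 := cell _ _ _ (lexx _) (le1 _) y1 (ltW y2).
have {}c1 : `|f x - f 0| <= L * ((Num.floor x)%:~R + 1 - x).
  rewrite -[f 0](fi (Num.floor x + 1)%R) intrD mulr1z.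
  by move: c1; rewrite [`|x - _|]distrC [`|_ + 1 - x|]ger0_norm// subr_ge0 ltW.
have {}c2 : `|f 0 - f y| <= L * (y - (Num.floor y)%:~R).
  rewrite -(fi (Num.floor y)).
  by move: c2; rewrite [`|_ - y|]distrC [`|y - (Num.floor y)%:~R|]ger0_norm// subr_ge0.
rewrite [`|x - y|]distrC [`|y - x|]ger0_norm ?subr_ge0//.
rewrite (_ : f x - f y = (f x - f 0) + (f 0 - f y)); last by ring.
rewrite (le_trans (ler_normD _ _))// (le_trans (lerD c1 c2))//.
rewrite -mulrDr ler_wpM2l//; lra.
Qed.

(** * Bounds for the field *)

Lemma within_continuous_bounded (R : realType) (a b c d : R) (f : R -> R -> R) :
  a <= b -> c <= d ->
  {within `[a, b] `*` `[c, d], continuous (fun z : R * R => f z.1 z.2)} ->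
  exists2 C, 0 <= C &
    forall t s, `[a, b]%classic t -> `[c, d]%classic s -> `|f t s| <= C.
Proof.
move=> ab cd cf; set D := _ `*` _ in cf.
have cD : compact D by apply: compact_setX; exact: segment_compact.
have D0 : D !=set0 by exists (a, c); split; rewrite /= in_itv/= lexx.
have cnf : {within D, continuous (fun z : R * R => `|f z.1 z.2|)}.
  by move=> z; apply: cvg_norm; exact: cf.
have [z _ zM] := compact_EVT_max D0 cD cnf.
exists `|f z.1 z.2| => // t s tab scd.
by have := zM (t, s); apply; apply: mem_set.
Qed.

(** f and its two first partial derivatives are continuous on the compact cell, hence bounded there;
    periodicity carries the bounds to every s. The sum of the three bounds serves for all three
    conclusions. *)
Lemma smooth_on_lipschitz (R : realType) (T : R) (f : R -> R -> R) : 0 < T ->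
  smooth_on `[0, T]%classic `[0, 1]%classic f ->
  (forall t s, 0 <= t <= T -> f t (s + 1) = f t s) ->
  exists2 C, 0 <= C & forall t t' s s', 0 <= t <= T -> 0 <= t' <= T ->
    [/\ `|f t s| <= C, `|f t s - f t' s| <= C * `|t - t'| &
        `|f t s - f t s'| <= C * `|s - s'|].
Proof.
move=> T0 sf f1; have [cf [df [c1 _] [c2 _]]] := sf 1.
have [C0 C00 f0C] := within_continuous_bounded (ltW T0) ler01 cf.
have [C1 C10 f1C] := within_continuous_bounded (ltW T0) ler01 c1.
have [C2 C20 f2C] := within_continuous_bounded (ltW T0) ler01 c2.
have in01 (x : R) : 0 <= x <= 1 -> `[0, 1]%classic x by rewrite /= in_itv.
have in0T (x : R) : 0 <= x <= T -> `[0, T]%classic x by rewrite /= in_itv.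
have C0' : C0 <= C0 + C1 + C2 by lra.
have C1' : C1 <= C0 + C1 + C2 by lra.
have C2' : C2 <= C0 + C1 + C2 by lra.
exists (C0 + C1 + C2); first by lra.
move=> t t' s s' tT t'T; split.
- have [y y01 ->] := periodic_reduce s (fun s => f1 t s tT).
  by apply: (le_trans (f0C t y _ _)); auto.
- have ft1 x : f t (x + 1) - f t' (x + 1) = f t x - f t' x by rewrite !f1.
  have [y y01 ->] := periodic_reduce s ft1.
  have fd u : `[0, T]%classic u ->
      diffquot_within `[0, T]%classic (f ^~ y) u -->
      partial1 `[0, T]%classic f u y.
    by move=> uT; exact: (df u y uT (in01 _ y01)).1.
  have fb u : `[0, T]%classic u -> `|partial1 `[0, T]%classic f u y| <= C1.
    by move=> uT; apply: f1C => //; exact: in01.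
  apply: (le_trans (within_derive_lipschitz fd fb tT t'T)).
  by rewrite ler_wpM2r.
- have fd u : `[0, 1]%classic u ->
      diffquot_within `[0, 1]%classic (f t) u --> partial2 `[0, 1]%classic f t u.
    by move=> u1; exact: (df t u (in0T _ tT) u1).2.
  have fb u : `[0, 1]%classic u -> `|partial2 `[0, 1]%classic f t u| <= C2.
    by move=> u1; apply: f2C => //; exact: in0T.
  apply: (le_trans (periodic_lipschitz C20 (fun s => f1 t s tT)
    (within_derive_lipschitz fd fb) s s')).
  by rewrite ler_wpM2r.
Qed.

Lemma field_lipschitz (R : realType) (T : R) (H : R -> R -> 'M[R]_3) : 0 < T ->
  field_assumptions T H ->
  exists2 C, 0 <= C & forall i j t t' s s', 0 <= t <= T -> 0 <= t' <= T ->
    [/\ `|H t s i j| <= C, `|H t s i j - H t' s i j| <= C * `|t - t'| &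
        `|H t s i j - H t s' i j| <= C * `|s - s'|].
Proof.
move=> T0 hH.
have E i j := smooth_on_lipschitz T0 (field_smooth hH i j)
  (fun t s tT => congr1 (fun M : 'M[R]_3 => M i j) (field_periodic hH s tT)).
pose C (ij : 'I_3 * 'I_3) := s2val (cid2 (E ij.1 ij.2)).
have CP0 ij : 0 <= C ij by exact: (s2valP (cid2 (E ij.1 ij.2))).
pose D := \sum_ij C ij; have CD ij : C ij <= D.
  by rewrite /D (bigD1 ij)//= lerDl sumr_ge0.
exists D; first by exact: sumr_ge0.
move=> i j t t' s s' tT t'T; have [h1 h2 h3] := s2valP' (cid2 (E i j)) t t' s s' tT t'T.
have {}CD : C (i, j) <= D by [].
split; first exact: le_trans CD.
- by apply: (le_trans h2); rewrite ler_wpM2r.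
- by apply: (le_trans h3); rewrite ler_wpM2r.
Qed.

(** * Linear change of variable in the Lebesgue integral *)

Lemma ge0_integral_scale (R : realType) (f : R -> \bar R) (c : R) (a b : R) :
  0 < c -> measurable_fun setT f -> (forall x, 0 <= f x)%E ->
  (\int[@lebesgue_measure R]_(x in `[(c * a)%R, (c * b)%R]) f x =
   c%:E * \int[@lebesgue_measure R]_(u in `[a, b]) f (c * u)%R)%E.
Proof.
move=> c0 mf f0.
pose phi : measurableTypeR R -> measurableTypeR R := fun u => c * u.
have mphi : measurable_fun setT phi by exact: mulrl_measurable.
have cn : 0 <= c by exact: ltW.
pose phi_mu := measure_function_pushforward__canonical__measure_function_Measure
  (@lebesgue_measure R) mphi.
pose nu := mscale (NngNum cn) phi_mu.
(* Lebesgue measure is c times its image under u -> c u: both give the same length to half-open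
   intervals, and uniqueness does the rest. *)
have nuE A : measurable A -> lebesgue_measure A = nu A.
  apply: (@lebesgue_measure_unique R nu) => _ [[x y]] _ <-.
  transitivity (c%:E * lebesgue_measure (phi @^-1` `]x, y]))%E; last by [].
  have -> : phi @^-1` `]x, y] = `]x / c, y / c]%classic.
    by apply/seteqP; split=> z; rewrite /= /phi !in_itv/= ltr_pdivrMr// ler_pdivlMr//
       mulrC.
  rewrite !lebesgue_measure_itv/= !lte_fin ltr_pM2r ?invr_gt0//.
  case: ifP => _; last by rewrite mule0.
  by rewrite -!EFinD -EFinM -mulrBl mulrCA divff ?mulr1// gt_eqF.
rewrite (@eq_measure_integral _ _ _ _ nu).
  rewrite ge0_integral_mscale//; last exact: measurable_funTS.
  rewrite ge0_integral_pushforward//; last exact: measurable_funTS.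
  congr (_ * _)%E; congr (integral _ _ _).
  apply/seteqP; split=> z; rewrite /= /phi !in_itv/= !ler_pM2l//.
by move=> A mA _; exact: nuE.
Qed.

Lemma Rintegral_scale (R : realType) (f : R -> R) (c a b : R) : 0 < c ->
  measurable_fun setT f ->
  (@lebesgue_measure R).-integrable `[a, b] (EFin \o (fun u => f (c * u))) ->
  \int[@lebesgue_measure R]_(x in `[c * a, c * b]) f x =
  c * \int[@lebesgue_measure R]_(u in `[a, b]) f (c * u).
Proof.
move=> c0 mf fi; have mI : measurable (`[a, b]%classic : set (measurableTypeR R)) by [].
have mEf : measurable_fun setT (EFin \o f) by exact/measurable_EFinP.
have fn := integrable_fin_num mI (integrable_funeneg mI fi).
rewrite /Rintegral.
transitivity (fine (c%:E * \int[@lebesgue_measure R]_(u in `[a, b]) (f (c * u))%:E)%E);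
  last by rewrite fineM//; exact: (integrable_fin_num mI fi).
congr fine; rewrite [LHS]integralE [in RHS]integralE.
rewrite (ge0_integral_scale a b c0 (measurable_funepos mEf))//.
rewrite (ge0_integral_scale a b c0 (measurable_funeneg mEf))//.
rewrite [RHS]muleBr//; last by apply: fin_num_adde_defl; rewrite fin_numN; exact: fn.
by congr (_ * _ - _ * _)%E; apply: eq_integral => x _; rewrite ?funeposE ?funenegE.
Qed.

(** * The micro problem *)

Lemma continuous_sum (R : realType) (T : topologicalType) (I : Type) (r : seq I)
    (f : I -> T -> R) :
  (forall i, continuous (f i)) -> continuous (fun x => \sum_(i <- r) f i x).
Proof.
move=> cf; elim: r => [|i r ih].
  by under eq_fun do rewrite big_nil; move=> x; exact: cvg_cst.
by under eq_fun do rewrite big_cons; move=> x; apply: cvgD; [exact: cf|exact: ih].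
Qed.

Lemma enorm_ge0 (R : realType) n (v : 'cV[R]_n) : 0 <= enorm v.
Proof. exact: sqrtr_ge0. Qed.

Lemma sqr_enorm (R : realType) n (v : 'cV[R]_n) : enorm v ^+ 2 = \sum_(i < n) v i 0 ^+ 2.
Proof. by rewrite sqr_sqrtr// sumr_ge0// => i _; exact: sqr_ge0. Qed.

Lemma ler_coord_enorm (R : realType) n (v : 'cV[R]_n) i : `|v i 0| <= enorm v.
Proof.
rewrite -ler_sqr ?nnegrE ?enorm_ge0// sqr_enorm real_normK ?num_real//.
by rewrite (bigD1 i)//= lerDl sumr_ge0// => j _; exact: sqr_ge0.
Qed.

Lemma enorm_le_sum (R : realType) n (v : 'cV[R]_n) : enorm v <= \sum_(i < n) `|v i 0|.
Proof.
have S0 : 0 <= \sum_(i < n) `|v i 0| by exact: sumr_ge0.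
rewrite -ler_sqr ?nnegrE ?enorm_ge0// sqr_enorm [leRHS]expr2 mulr_suml.
apply: ler_sum => i _; rewrite -real_normK ?num_real// expr2 ler_wpM2l//.
by rewrite (bigD1 i)//= lerDl sumr_ge0.
Qed.

Lemma ler_norm_sum3 (R : realType) (f : 'I_3 -> R) (B : R) :
  (forall j, `|f j| <= B) -> `|\sum_(j < 3) f j| <= 3 * B.
Proof.
move=> fB; apply: (le_trans (ler_norm_sum _ _ _)).
apply: (@le_trans _ _ (\sum_(j < 3) B)); first by apply: ler_sum => j _.
by rewrite sumr_const card_ord mulr_natl.
Qed.

Lemma within_is_derive0_cst (R : realType) (f : R -> R) (a b : R) :
  {within `[a, b], continuous f} -> (forall x : R, a < x < b -> is_derive x 1 f 0) ->
  forall x y, a <= x <= b -> a <= y <= b -> f x = f y.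
Proof.
move=> cf df x y; wlog xy : x y / x <= y.
  move=> H xab yab; case: (leP x y) => [xy|/ltW yx]; first exact: H.
  by apply/esym; exact: H.
move=> /andP[ax xb] /andP[ay yb].
have cfxy : {within `[x, y], continuous f}.
  by apply: continuous_subspaceW cf; apply: subset_itv; rewrite bnd_simp.
have dfxy z : z \in `]x, y[%R -> is_derive z 1 f ((fun=> 0) z).
  rewrite in_itv/= => /andP[xz zy]; apply: df.
  by rewrite (le_lt_trans ax xz) (lt_le_trans zy yb).
have [c _] := MVT_segment xy dfxy cfxy.
by rewrite mul0r => /eqP; rewrite subr_eq0 => /eqP.
Qed.

(** The algebraic source of the conservation of |m|: H m is orthogonal to m. *)
Lemma skew_mx_quadratic (R : realType) (h1 h2 h3 : R) (v : 'cV[R]_3) :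
  \sum_(i < 3) v i 0 * (skew_mx h1 h2 h3 *m v) i 0 = 0.
Proof.
rewrite !big_ord_recl big_ord0 !mxE !big_ord_recl !big_ord0 !mxE /=.
ring.
Qed.

Lemma micro_solution_coord (R : realType) (H : R -> R -> 'M[R]_3) eps tau ta M m
    (i : 'I_3) t :
  micro_solution H eps tau ta M m -> micro_window tau t ->
  diffquot_within (micro_window tau) (fun u => m u i 0) t -->
    - (H (t + ta) ((t + ta) / eps) *m m t) i 0.
Proof.
move=> [sol _] tW; have [cvm dm] := sol t tW.
have {}cvm : diffquot_within (micro_window tau) m t --> - (H (t + ta) ((t + ta) / eps) *m m t).
  by rewrite -dm; exact: cvm.
have := cvg_comp _ _ cvm (@coord_continuous R 3 1 i 0 _).
rewrite mxE; apply: cvg_trans; apply: near_eq_cvg; near=> u.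
by rewrite /= !mxE.
Unshelve. all: by end_near. Qed.

(** The squared Euclidean norm has derivative 2 m . m' = 0 in the interior and is continuous up to
    the ends, so it keeps its value at 0 over the whole window. *)
Lemma micro_solution_bound (R : realType) (T : R) (H : R -> R -> 'M[R]_3)
    eps tau ta M m (i : 'I_3) t :
  (forall t s : R, 0 <= t <= T -> exists h1 h2 h3, H t s = skew_mx h1 h2 h3) ->
  0 < tau -> (forall s, micro_window tau s -> 0 <= s + ta <= T) ->
  micro_solution H eps tau ta M m -> micro_window tau t ->
  `|m t i 0| <= enorm M.
Proof.
move=> skew tau0 winT sol tW.
have dm (j : 'I_3) (u : R) := @micro_solution_coord R H eps tau ta M m j u sol.
have W0 : - (tau / 2) <= 0 <= tau / 2.
  by rewrite oppr_le0 divr_ge0// ltW.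
have inW x : - (tau / 2) <= x <= tau / 2 -> micro_window tau x.
  by rewrite /micro_window /= in_itv.
have cm j : {within micro_window tau, continuous (fun u => m u j 0)}.
  exact: (within_derivable_continuous (dm j)).
pose N u := \sum_(j < 3) m u j 0 * m u j 0.
have cN : {within micro_window tau, continuous N}.
  by apply: continuous_sum => j u; apply: cvgM; exact: cm.
have dN u : - (tau / 2) < u < tau / 2 -> is_derive u 1 N 0.
  move=> uW; have uW' : micro_window tau u.
    by apply: inW; case/andP: uW => /ltW-> /ltW->.
  have d j : is_derive u 1 (fun v => m v j 0)
      (- (H (u + ta) ((u + ta) / eps) *m m u) j 0).
    by apply: is_derive_within_itv uW _; exact: dm.
  have [h1 [h2 [h3 Hs]]] := skew _ ((u + ta) / eps) (winT u uW').
  (* Zero is rewritten in the shape produced by differentiating the sum of squares termwise. *)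
  have -> : 0 = \sum_(j < 3) (- (H (u + ta) ((u + ta) / eps) *m m u) j 0 * m u j 0 +
      m u j 0 * - (H (u + ta) ((u + ta) / eps) *m m u) j 0) :> R.
    have := skew_mx_quadratic h1 h2 h3 (m u); rewrite -Hs => Q.
    transitivity (- 2 * \sum_(j < 3) m u j 0 * (H (u + ta) ((u + ta) / eps) *m m u) j 0).
      by rewrite Q mulr0.
    by rewrite mulr_sumr; apply: eq_bigr => j _; ring.
  have -> : N = \sum_(j < 3) (fun v => m v j 0 * m v j 0).
    by apply/funext => v; rewrite fct_sumE.
  by apply: is_derive_sum => j; exact: is_derive1M.
have Nt : N t = enorm M ^+ 2.
  have tW' : - (tau / 2) <= t <= tau / 2 by move: tW; rewrite /micro_window /= in_itv.
  rewrite (within_is_derive0_cst cN dN tW' W0) sqr_enorm /N sol.2.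
  by apply: eq_bigr => j _; rewrite expr2.
rewrite -ler_sqr ?nnegrE ?enorm_ge0// real_normK ?num_real// -Nt.
rewrite /N (bigD1 i)//= expr2 lerDl sumr_ge0// => j _.
by rewrite -expr2 sqr_ge0.
Qed.

Lemma average_mulmx (R : realType) (H : R -> R -> 'M[R]_3) (t : R) (M : 'cV[R]_3) i :
  (forall j, continuous (fun s => H t s i j)) ->
  (average H t *m M) i 0 =
  \int[@lebesgue_measure R]_(s in `[0, 1]) (\sum_(j < 3) H t s i j * M j 0).
Proof.
move=> cH; rewrite mxE.
have cHM j : continuous (fun s => H t s i j * M j 0).
  by move=> s; apply: cvgM; [exact: cH|exact: cvg_cst].
have iH j : lebesgue_measure.-integrable `[0, 1] (EFin \o (fun s => H t s i j)).
  exact: continuous_integrable_itv.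
suff sumE (r : seq 'I_3) : \sum_(j <- r) average H t i j * M j 0 =
    \int[@lebesgue_measure R]_(s in `[0, 1]) (\sum_(j <- r) H t s i j * M j 0).
  exact: sumE.
elim: r => [|j r ih].
  rewrite big_nil; under eq_Rintegral do rewrite big_nil.
  by rewrite Rintegral_cst// mul0r.
rewrite big_cons ih; under [RHS]eq_Rintegral do rewrite big_cons.
rewrite RintegralD//; first by rewrite RintegralZr// mxE.
- exact: continuous_integrable_itv.
- by apply: continuous_integrable_itv; exact: continuous_sum.
Qed.

(** * Estimates on one window, with a field bound C fixed independently of it *)

Section window.
Variables (R : realType) (T : R) (H : R -> R -> 'M[R]_3) (C : R).
Variables (eps tau ta : R) (M : 'cV[R]_3) (m : R -> 'cV[R]_3).
Hypothesis H_skew : forall t s : R, 0 <= t <= T ->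
  exists h1 h2 h3, H t s = skew_mx h1 h2 h3.
Hypothesis C0 : 0 <= C.
Hypothesis H_lip : forall i j t t' s s', 0 <= t <= T -> 0 <= t' <= T ->
  [/\ `|H t s i j| <= C, `|H t s i j - H t' s i j| <= C * `|t - t'| &
      `|H t s i j - H t s' i j| <= C * `|s - s'|].
Hypotheses (eps0 : 0 < eps) (tau0 : 0 < tau).
Hypothesis winT : forall s, micro_window tau s -> 0 <= s + ta <= T.
Hypothesis sol : micro_solution H eps tau ta M m.

Let in_window s : - (tau / 2) <= s <= tau / 2 -> micro_window tau s.
Proof. by rewrite /micro_window /= in_itv. Qed.

Let window0 : - (tau / 2) <= 0 <= tau / 2.
Proof. by rewrite oppr_le0 divr_ge0// ltW. Qed.

Lemma micro_solution_lipschitz i s s' :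
  - (tau / 2) <= s <= tau / 2 -> - (tau / 2) <= s' <= tau / 2 ->
  `|m s i 0 - m s' i 0| <= 3 * (C * enorm M) * `|s - s'|.
Proof.
pose d u := - (H (u + ta) ((u + ta) / eps) *m m u) i 0.
have dm u : micro_window tau u -> diffquot_within (micro_window tau)
    (fun v => m v i 0) u --> d u by exact: micro_solution_coord sol.
apply: (within_derive_lipschitz dm) => u uW.
rewrite normrN mxE; apply: ler_norm_sum3 => j; rewrite normrM ler_pM//.
  by have [] := H_lip i j ((u + ta) / eps) 0 (winT uW) (winT uW).
exact: (micro_solution_bound j H_skew tau0 winT sol).
Qed.

(** Only the slow time and the solution are frozen; the fast argument (s + ta) / eps is kept, since
    its variation over the window is not small. Freezing the time costs C tau |M|, freezing m costs
    C times 3 C |M| tau, and the outer 3 counts the terms of the matrix product. *)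
Lemma micro_velocity_error i s : - (tau / 2) <= s <= tau / 2 ->
  `|- (H (s + ta) ((s + ta) / eps) *m m s) i 0 +
    \sum_(j < 3) H ta ((s + ta) / eps) i j * M j 0| <=
  3 * ((C + 3 * C ^+ 2) * tau * enorm M).
Proof.
move=> sW; have e0 := enorm_ge0 M.
have sT := winT (in_window sW).
have taT : 0 <= ta <= T by rewrite -[ta]add0r; exact: winT (in_window window0).
rewrite mxE -sumrN -big_split; apply: ler_norm_sum3 => j /=.
rewrite (_ : - _ + _ = - ((H (s + ta) ((s + ta) / eps) i j -
    H ta ((s + ta) / eps) i j) * M j 0) -
    H (s + ta) ((s + ta) / eps) i j * (m s j 0 - m 0 j 0)); last first.
  by rewrite sol.2; ring.
have s_le : `|s| <= tau by rewrite ler_norml; case/andP: sW => ? ?; apply/andP; split; lra.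
apply: (le_trans (ler_normB _ _)); rewrite normrN !normrM.
have [HC Ht _] := H_lip i j ((s + ta) / eps) 0 sT taT.
rewrite addrK in Ht.
have h1 : `|H (s + ta) ((s + ta) / eps) i j - H ta ((s + ta) / eps) i j| * `|M j 0| <=
    C * tau * enorm M.
  rewrite ler_pM ?ler_coord_enorm//; apply: (le_trans Ht).
  by rewrite ler_wpM2l.
have h2 : `|H (s + ta) ((s + ta) / eps) i j| * `|m s j 0 - m 0 j 0| <=
    C * (3 * (C * enorm M) * tau).
  rewrite ler_pM//; apply: (le_trans (micro_solution_lipschitz j sW window0)).
  by rewrite subr0 ler_wpM2l// !mulr_ge0.
apply: (le_trans (lerD h1 h2)); rewrite le_eqVlt; apply/orP; left; apply/eqP; ring.
Qed.

(** The Lipschitz constant C + C / eps blows up as eps tends to 0, but only measurability is drawn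
    from it. *)
Lemma micro_velocity_measurable i :
  measurable_fun (micro_window tau)
    (fun s => - (H (s + ta) ((s + ta) / eps) *m m s) i 0).
Proof.
apply: measurableT_comp => //.
under eq_fun do rewrite mxE; apply: measurable_sum => j; apply: measurable_funM.
  apply: (@lipschitz_measurable_itv _ _ _ _ (C + C / eps)) => s s' sW s'W.
  have sT := winT (in_window sW); have s'T := winT (in_window s'W).
  have [_ h1 _] := H_lip i j ((s + ta) / eps) 0 sT s'T.
  have [_ _ h2] := H_lip i j ((s + ta) / eps) ((s' + ta) / eps) s'T s'T.
  rewrite -(subrKA (H (s' + ta) ((s + ta) / eps) i j)).
  apply: (le_trans (ler_normD _ _)); rewrite [leRHS]mulrDl.
  have E : s + ta - (s' + ta) = s - s' by ring.
  rewrite E in h1; rewrite -mulrBl E normrM normfV (gtr0_norm eps0) in h2.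
  by rewrite lerD// mulrAC -mulrA.
apply: (@lipschitz_measurable_itv _ _ _ _ (3 * (C * enorm M))) => s s' sW s'W.
exact: micro_solution_lipschitz.
Qed.

(** After s = tau u, the velocity splits into the freezing error [E], the mean-zero oscillation [F]
    and the constant mean [c]; as K has mass 1, the last cancels the averaged field exactly. The
    oscillation estimate is a hypothesis so that [Cosc] is chosen before the parameters. *)
Lemma flux_averaged p q (K : R -> R) (Cosc : R) i : kernel_class p q K ->
  (forall (f : R -> R) (L B l b : R),
    (forall x y, `|f x - f y| <= L * `|x - y|) -> (forall x, f (x + 1) = f x) ->
    \int[@lebesgue_measure R]_(x in `[0, 1]) f x = 0 ->
    (forall x, `|f x| <= B) -> 1 <= l ->
    `|\int[@lebesgue_measure R]_(u in `[- 2^-1, 2^-1]) (K u * f (l * u + b))| <=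
      Cosc * B * l^-1 ^+ (absz (q + 1)).+1) ->
  (forall s : R, H ta (s + 1) = H ta s) -> eps < tau ->
  `|(flux K tau m + average H ta *m M) i 0| <=
    (\int[@lebesgue_measure R]_(u in `[- 2^-1, 2^-1]) `|K u|) *
      (3 * ((C + 3 * C ^+ 2) * tau * enorm M)) +
    Cosc * (6 * C * enorm M) * (eps / tau) ^+ (absz (q + 1)).+1.
Proof.
move=> kK osc H1 et; have e0 := enorm_ge0 M.
have taT : 0 <= ta <= T by rewrite -[ta]add0r; exact: winT (in_window window0).
have iK := kernel_integrable kK; have mK := kernel_measurable kK.
pose G s := \sum_(j < 3) H ta s i j * M j 0.
have cH j : continuous (fun s => H ta s i j).
  apply: (@lipschitz_continuous _ _ C) => x y.
  by have [] := H_lip i j x y taT taT.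
pose c := (average H ta *m M) i 0.
have cE : c = \int[@lebesgue_measure R]_(s in `[0, 1]) G s by exact: average_mulmx.
have GL x y : `|G x - G y| <= 3 * (C * enorm M) * `|x - y|.
  rewrite /G -sumrB -mulrA; apply: ler_norm_sum3 => j.
  rewrite -mulrBl normrM mulrAC ler_pM ?ler_coord_enorm//.
  by have [] := H_lip i j x y taT taT.
have GB x : `|G x| <= 3 * (C * enorm M).
  apply: ler_norm_sum3 => j; rewrite normrM ler_pM ?ler_coord_enorm//.
  by have [] := H_lip i j x 0 taT taT.
have cG := lipschitz_continuous GL.
have iG : lebesgue_measure.-integrable `[0, 1] (EFin \o G).
  exact: continuous_integrable_itv.
have cB : `|c| <= 3 * (C * enorm M).
  have := ler_norm_Rintegral_itv ler01 iG (fun x _ => GB x).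
  by rewrite subr0 mulr1 -cE.
pose F s := G s - c.
have FL x y : `|F x - F y| <= 3 * (C * enorm M) * `|x - y|.
  by rewrite /F opprB addrA subrK; exact: GL.
have F1 x : F (x + 1) = F x by rewrite /F /G H1.
have F0 : \int[@lebesgue_measure R]_(s in `[0, 1]) F s = 0.
  rewrite RintegralB//; last by apply: continuous_integrable_itv => x; exact: cvg_cst.
  by rewrite -cE Rintegral_cst//= lebesgue_measure_itv/= lte_fin ltr01 oppr0 adde0 mulr1 subrr.
(* Three terms for G and as much again for its mean. *)
have FB x : `|F x| <= 6 * C * enorm M.
  apply: (le_trans (ler_normB _ _)); apply: (le_trans (lerD (GB x) cB)).
  by rewrite le_eqVlt; apply/orP; left; apply/eqP; ring.
have cF := lipschitz_continuous FL.
pose l := tau / eps; pose b := ta / eps.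
have lbE u : l * u + b = (tau * u + ta) / eps by rewrite /l /b; ring.
have l1 : 1 <= l by rewrite ler_pdivlMr// mul1r ltW.
have clb : continuous (fun u : R => l * u + b).
  by move=> u; apply: cvgD; [apply: cvgM; [exact: cvg_cst|exact: cvg_id]|exact: cvg_cst].
have cFl : continuous (fun u => F (l * u + b)).
  by move=> u; apply: (@continuous_comp _ _ _ (fun u : R => l * u + b) F); [exact: clb|exact: cF].
have cGl : continuous (fun u => G (l * u + b)).
  by move=> u; apply: (@continuous_comp _ _ _ (fun u : R => l * u + b) G); [exact: clb|exact: cG].
have {}osc := osc F _ _ l b FL F1 F0 FB l1.
pose D s := - (H (s + ta) ((s + ta) / eps) *m m s) i 0.
(* Outside the window nothing is known about m; extension by zero gives the measurability on the
   whole line that the change of variable requires. *)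
pose Dt := D \_ (micro_window tau).
have mDt : measurable_fun setT Dt.
  apply/(measurable_restrictT _ _).1; first exact: measurable_itv.
  exact: micro_velocity_measurable.
have uW u : - 2^-1 <= u <= 2^-1 -> - (tau / 2) <= tau * u <= tau / 2.
  by case/andP => u1 u2; rewrite -mulrN !ler_pM2l// u1.
pose E u := Dt (tau * u) + G (l * u + b).
have EB u : - 2^-1 <= u <= 2^-1 -> `|E u| <= 3 * ((C + 3 * C ^+ 2) * tau * enorm M).
  move=> /uW u2; rewrite /E /Dt patchE ifT; last exact/mem_set/in_window.
  by rewrite /G lbE; exact: micro_velocity_error.
have mE : measurable_fun setT E.
  apply: measurable_funD; last exact: continuous_measurable_fun.
  by apply: measurableT_comp => //; exact: mulrl_measurable.
have iKE : (@lebesgue_measure R).-integrable `[- 2^-1, 2^-1] (EFin \o (fun u => K u * E u)).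
  by apply: integrable_mul_bounded EB => //; exact: measurable_funTS.
have iKF : (@lebesgue_measure R).-integrable `[- 2^-1, 2^-1]
    (EFin \o (fun u => K u * F (l * u + b))).
  apply: (integrable_mul_bounded (E := 6 * C * enorm M)) => //.
  by apply: measurable_funTS; exact: continuous_measurable_fun.
have iKc : (@lebesgue_measure R).-integrable `[- 2^-1, 2^-1] (EFin \o (fun u => K u * c)).
  apply: (integrable_mul_bounded (E := `|c|)) => //.
have KDE u : K u * Dt (tau * u) = K u * E u - K u * F (l * u + b) - K u * c.
  by rewrite /E /F; ring.
have iKD : (@lebesgue_measure R).-integrable `[- 2^-1, 2^-1]
    (EFin \o (fun u => K u * E u - K u * F (l * u + b))).
  by have := integrableB _ iKE iKF; exact.
have iKDt : (@lebesgue_measure R).-integrable `[- 2^-1, 2^-1]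
    (EFin \o (fun u => K u * Dt (tau * u))).
  rewrite (funext KDE).
  by have := integrableB _ iKD iKc; exact.
have fluxE : flux K tau m i 0 =
    \int[@lebesgue_measure R]_(u in `[- 2^-1, 2^-1]) (K u * Dt (tau * u)).
  pose g s := tau^-1 * (K (tau^-1 * s) * Dt s).
  have gE u : g (tau * u) = tau^-1 * (K u * Dt (tau * u)).
    by rewrite /g mulKf ?gt_eqF.
  have mg : measurable_fun setT g.
    apply: measurable_funM => //; apply: measurable_funM => //.
    by apply: measurableT_comp => //; exact: mulrl_measurable.
  have ig : (@lebesgue_measure R).-integrable `[- 2^-1, 2^-1]
      (EFin \o (fun u => g (tau * u))).
    rewrite (funext gE).
    by have := integrableZl _ tau^-1 iKDt; exact.
  transitivity (\int[@lebesgue_measure R]_(s in `[tau * - 2^-1, tau * 2^-1]) g s).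
    rewrite mxE mulrN; apply: eq_Rintegral => s /set_mem sW.
    rewrite /g /Dt patchE ifT; last exact: mem_set.
    rewrite /scaled_kernel (sol.1 s sW).2 -mulrA [s / tau]mulrC.
    by rewrite [X in _ * (_ * X)]mxE.
  rewrite Rintegral_scale//; under eq_Rintegral do rewrite gE.
  by rewrite RintegralZl// mulrA divff ?gt_eqF// mul1r.
have -> : (flux K tau m + average H ta *m M) i 0 =
    \int[@lebesgue_measure R]_(u in `[- 2^-1, 2^-1]) (K u * E u) -
    \int[@lebesgue_measure R]_(u in `[- 2^-1, 2^-1]) (K u * F (l * u + b)).
  rewrite mxE -/c fluxE; under eq_Rintegral do rewrite KDE.
  rewrite RintegralB// RintegralB// RintegralZr// (kernel_mass_itv kK).
  by rewrite mul1r subrK.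
apply: (le_trans (ler_normB _ _)); apply: lerD; last first.
  by move: osc; rewrite /l invf_div.
apply: (le_trans (le_normr_Rintegral _ iKE)) => //.
rewrite -RintegralZr//; last exact: (integrable_norm iK).
apply: le_Rintegral => //.
- exact: (integrable_norm iKE).
- by have := integrableZr _ (3 * ((C + 3 * C ^+ 2) * tau * enorm M)) (integrable_norm iK); exact.
- by move=> u /=; rewrite in_itv/= => uI; rewrite normrM ler_wpM2l// EB.
Qed.

End window.

Theorem theorem1 (R : realType) (T : R) (hT : 0 < T)
    (H : R -> R -> 'M[R]_3) (hH : field_assumptions T H)
    (p : nat) (q : int) (hq : -1 <= q) (K : R -> R) (hK : kernel_class p q K) :
  exists C1 : R, forall eps tau ta : R,
    0 < eps -> eps < 1 -> eps < tau ->
    `[ta - tau / 2, ta + tau / 2]%classic `<=` `[0, T]%classic ->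
    forall (M : 'cV[R]_3) (m : R -> 'cV[R]_3),
      micro_solution H eps tau ta M m ->
      enorm (flux K tau m + average H ta *m M) <=
        C1 * (tau + (eps / tau) ^ (q + 2)) * enorm M.
Proof.
have [C C0 H_lip] := field_lipschitz hT hH.
have [Co Co0 osc] := kernel_oscillation hK.
have skew t s : 0 <= t <= T -> exists h1 h2 h3, H t s = skew_mx h1 h2 h3.
  have [H1 [H2 [H3 HE]]] := field_skew hH.
  by move=> tT; exists (H1 t s), (H2 t s), (H3 t s); exact: HE.
set I := \int[@lebesgue_measure R]_(u in `[- 2^-1, 2^-1]) `|K u|.
have I0 : 0 <= I by apply: Rintegral_ge0 => x _.
(* The outer factors 3 come from bounding the Euclidean norm by the sum of three coordinates. *)
pose A := 3 * (I * (3 * (C + 3 * C ^+ 2))); pose B := 3 * (Co * (6 * C)).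
exists (A + B) => eps tau ta eps0 _ et win M m sol.
have tau0 : 0 < tau by exact: lt_trans et.
have winT s : micro_window tau s -> 0 <= s + ta <= T.
  rewrite /micro_window /= in_itv/= => /andP[s1 s2].
  have /win : `[ta - tau / 2, ta + tau / 2]%classic (s + ta).
    by rewrite /= in_itv/=; apply/andP; split; lra.
  by rewrite /= in_itv.
have taT : 0 <= ta <= T.
  rewrite -[ta]add0r; apply: winT; rewrite /micro_window /= in_itv/=.
  by rewrite oppr_le0 divr_ge0// ltW.
have e0 := enorm_ge0 M.
(* As q >= -1, the integer q + 1 is its own absolute value, so the integer power is a natural
   one. *)
have -> : (eps / tau) ^ (q + 2) = (eps / tau) ^+ (absz (q + 1)).+1.
  have q1 : 0 <= q + 1 by rewrite -lerBlDr sub0r.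
  by rewrite exprnP intS gez0_abs//; congr (_ ^ _); ring.
have H1 s : H ta (s + 1) = H ta s by exact: (field_periodic hH).
have comp i := @flux_averaged _ _ _ _ _ _ _ _ _ skew C0 H_lip eps0 tau0 winT sol _ _ _ _ i hK osc H1 et.
rewrite -/I in comp.
set x := (eps / tau) ^+ _ in comp *.
have x0 : 0 <= x by rewrite exprn_ge0// divr_ge0 ?ltW.
apply: (le_trans (enorm_le_sum _)).
apply: (le_trans (ler_sum _ (fun i _ => comp i))).
rewrite sumr_const card_ord -mulr_natl.
have A0 : 0 <= A by rewrite /A !(mulr_ge0, addr_ge0, exprn_ge0).
have B0 : 0 <= B by rewrite /B !mulr_ge0.
apply: (@le_trans _ _ ((A * tau + B * x) * enorm M)).
  by rewrite le_eqVlt; apply/orP; left; apply/eqP; rewrite /A /B; ring.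
by rewrite ler_wpM2r// mulrDr lerD// ler_wpM2r ?lerDl ?lerDr// ltW.
Qed.
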